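(* Let $(\mathcal A_1,\varphi_1)$ and $(\mathcal A_2,\varphi_2)$ be two (not necessarily unital) associative $k$-algebras equipped with linear forms, let $\mathcal A:=\mathcal A_1\star\mathcal A_2$ be their non-unital free product, and let $\Phi_1,\Phi_2$ be the characters on $\overline T(T(\mathcal A))$ associated with $\varphi_1,\varphi_2$. Then the Speicher--Muraki monotone, anti-monotone, free and boolean products of $\varphi_1$ and $\varphi_2$ are the restrictions to $\mathcal A\subset T(T(\mathcal A))$ of, respectively, the characters (i) $\Phi_1*\Phi_2$ (monotone product); (ii) $\Phi_2*\Phi_1$ (anti-monotone product); (iii) $\Phi_1\,\Box_\prec\,\Phi_2$ (free product); (iv) $\Phi_1\,\Box_\succ\,\Phi_2$ (boolean product).
   Context: $k$ is a field of characteristic zero. Double tensor algebra of an associative $k$-algebra $\mathcal A$. $T(\mathcal A)=\bigoplus_{n>0}\mathcal A^{\otimes n}$, elements written as words $a_1\cdots a_n$ ($=a_1\otimes\cdots\otimes a_n$); products in $\mathcal A$ are written $a_1\cdot_{\mathcal A}\cdots\cdot_{\mathcal A}a_n$. $\overline H=\overline T(T(\mathcal A))=\bigoplus_{n\ge0}T(\mathcal A)^{\otimes n}=k\mathbf 1\oplus H$ with concatenation product $w_1|\cdots|w_m$. For $S=\{s_1<\dots<s_p\}\subseteq[n]$, $a_S:=a_{s_1}\cdots a_{s_p}$ ($a_\emptyset=\mathbf 1$); if $J_1,\dots,J_l$ (in increasing order) are the maximal intervals of consecutive integers in $[n]\setminus S$, $a_{J^S_{[n]}}:=a_{J_1}|\cdots|a_{J_l}$.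 Coproduct: $\Delta(a_1\cdots a_n)=\sum_{S\subseteq[n]}a_S\otimes a_{J^S_{[n]}}$, extended multiplicatively. $\Delta^+_\prec(a_1\cdots a_n):=\sum_{1\in S}a_S\otimes a_{J^S_{[n]}}$, $\Delta^+_\succ(a_1\cdots a_n):=\sum_{1\notin S}a_S\otimes a_{J^S_{[n]}}$, extended by $\Delta^+_{\prec}(w_1|\cdots|w_m)=\Delta^+_\prec(w_1)\Delta(w_2)\cdots\Delta(w_m)$ (likewise $\Delta^+_\succ$); $\Delta_\prec(x)=\Delta^+_\prec(x)-x\otimes\mathbf 1$, $\Delta_\succ(x)=\Delta^+_\succ(x)-\mathbf 1\otimes x$ on $H$. $e$ is the augmentation; $f*g=m_k(f\otimes g)\Delta$ for linear forms on $\overline H$; for linear forms vanishing on $\mathbf 1$, $f\prec g=m_k(f\otimes g)\Delta_\prec$, $f\succ g=m_k(f\otimes g)\Delta_\succ$, extended by $e\succ f=f=f\prec e$, $e\prec f=0=f\succ e$. $G_H(k)$: characters (unital algebra maps $\overline H\to k$); $g_H(k)$: linear forms $\gamma$ with $\gamma(\mathbf 1)=0$, $\gamma(x|y)=0$ for $x,y\in H$. $\mathcal E_\prec(\alpha)$ (resp. $\mathcal E_\succ(\alpha)$), for $\alpha\in g_H(k)$, is the unique solution of $\Phi=e+\alpha\prec\Phi$ (resp. $\Phi=e+\Phi\succ\alpha$); both maps are bijections $g_H(k)\to G_H(k)$. The left and right additive convolutions on $G_H(k)$ are $\mathcal E_\prec(\gamma_1)\,\Box_\prec\,\mathcal E_\prec(\gamma_2):=\mathcal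 E_\prec(\gamma_1+\gamma_2)$ and $\mathcal E_\succ(\gamma_1)\,\Box_\succ\,\mathcal E_\succ(\gamma_2):=\mathcal E_\succ(\gamma_1+\gamma_2)$. Free product. An alternating word is $w=x_1\cdots x_n$, $n\ge1$, with $x_i\in\mathcal A_{\epsilon_i}$, $\epsilon_i\in\{1,2\}$, $\epsilon_i\ne\epsilon_{i+1}$; as a vector space $\mathcal A=\mathcal A_1\star\mathcal A_2$ is the direct sum over alternating sequences $\epsilon$ of the spaces $\mathcal A_{\epsilon_1}\otimes\cdots\otimes\mathcal A_{\epsilon_n}$. $\mathcal A$ is regarded as a subspace of $T(\mathcal A)\subset T(T(\mathcal A))$ by sending the alternating word $x_1\cdots x_n$ to the word $x_1\otimes\cdots\otimes x_n\in\mathcal A^{\otimes n}$ with letters $x_i\in\mathcal A_{\epsilon_i}\subset\mathcal A$. The form $\varphi_i$ is extended to $\mathcal A$ by $0$ on alternating words containing a letter not in $\mathcal A_i$; then to $T(\mathcal A)$ by $\varphi_i(a_1\cdots a_n):=\varphi_i(a_1\cdot_{\mathcal A}\cdots\cdot_{\mathcal A}a_n)$; and $\Phi_i(w_1|\cdots|w_m):=\varphi_i(w_1)\cdots\varphi_i(w_m)$, $\Phi_i(\mathbf 1)=1$. Universal products (linear forms on $\mathcal A$), for an alternating word $w=x_1\cdots x_n$, with ordered products and the convention that a form applied to an empty product is $1$: monotone: $w\mapsto\varphi_1\big(\prod_{x_i\in\mathcal A_1}x_i\big)\prod_{x_j\in\mathcal A_2}\varphi_2(x_j)$; anti-monotone: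 $w\mapsto\varphi_2\big(\prod_{x_j\in\mathcal A_2}x_j\big)\prod_{x_i\in\mathcal A_1}\varphi_1(x_i)$; boolean: $w\mapsto\prod_{x_i\in\mathcal A_1}\varphi_1(x_i)\prod_{x_j\in\mathcal A_2}\varphi_2(x_j)$; free: the unique linear form $\varphi$ on $\mathcal A$ with $\varphi|_{\mathcal A_i}=\varphi_i$ whose unital extension to the unitization $k1\oplus\mathcal A$ makes $k1\oplus\mathcal A_1$ and $k1\oplus\mathcal A_2$ freely independent, equivalently determined recursively by $\varphi(w)=\sum_{I\subsetneq[n]}(-1)^{n-|I|+1}\varphi\big(\prod_{i\in I}x_i\big)\prod_{i\notin I}\varphi_{\epsilon_i}(x_i)$. *)

(* Defs.v *)
From HB Require Import structures.
From mathcomp Require Import all_boot all_order all_algebra finmap.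
From mathcomp Require Import boolp.
From mathcomp Require Import monalg.

Set Implicit Arguments.
Unset Strict Implicit.
Unset Printing Implicit Defensive.

Import GRing.Theory.
Local Open Scope ring_scope.

(* The constructions below are sealed only to keep unification from
   unfolding them. *)
Fact seal_key : unit.
Proof. exact: tt. Qed.

Section Presentation.
Variables (k : fieldType) (X : choiceType) (R : {malg k[X]} -> Prop).
Local Notation F := {malg k[X]}.

Definition submodule (S : F -> Prop) : Prop :=
  S 0 /\ forall a x y, S x -> S y -> S (a *: x + y).

Definition spanned (x : F) : Prop :=
  forall S, submodule S -> (forall r, R r -> S r) -> S x.

Lemma spanned_submodule : submodule spanned.
Proof.
split=> [S [S0 _] _ //|a x y hx hy S hS hR].
by apply: hS.2; [apply: hx|apply: hy].
Qed.

Lemma spanned_rel r : R r -> spanned r.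
Proof. by move=> hr S _; apply. Qed.

Definition span_pred : {pred F} := fun x => `[< spanned x >].

Lemma span_zmod_closed : zmod_closed span_pred.
Proof.
have [h0 hD] := spanned_submodule; split; first exact/asboolP.
move=> x y /asboolP hx /asboolP hy; apply/asboolP.
by rewrite addrC -scaleN1r; apply: hD.
Qed.

HB.instance Definition _ := GRing.isZmodClosed.Build F span_pred span_zmod_closed.

(* The k-vector space with generators X and relations r = 0 for r in R. *)
Record presented : Type := Presented { unpresented : Quotient.quot span_pred }.

HB.instance Definition _ := [isNew for unpresented].
HB.instance Definition _ := [Choice of presented by <:].

Definition pproj (x : F) : presented :=
  locked_with seal_key (fun x => Presented (\pi_(Quotient.quot span_pred)%qT x)) x.

Definition prepr (x : presented) : F :=
  locked_with seal_key (fun x => repr (unpresented x)) x.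

Lemma pproj_eq x y : pproj x = pproj y <-> spanned (x - y).
Proof.
rewrite /pproj !locked_withE; split=> [[/eqP]|h].
  by rewrite -Quotient.idealrBE => /asboolP.
congr Presented.
by apply/eqP; rewrite -Quotient.idealrBE; apply/asboolP.
Qed.

Lemma pprojK (x : presented) : pproj (prepr x) = x.
Proof. by rewrite /pproj /prepr !locked_withE reprK; case: x. Qed.

Definition padd (x y : presented) : presented := pproj (prepr x + prepr y).
Definition pscale (a : k) (x : presented) : presented := pproj (a *: prepr x).

Lemma spannedK x : spanned (x - prepr (pproj x)).
Proof. by apply/pproj_eq; rewrite pprojK. Qed.

Lemma spanned_comb a x y : spanned x -> spanned y -> spanned (a *: x + y).
Proof. exact: spanned_submodule.2. Qed.

Lemma padd_proj x y : pproj (x + y) = padd (pproj x) (pproj y).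
Proof.
apply/pproj_eq; rewrite opprD addrACA -[x - _]scale1r.
by apply: spanned_comb; apply: spannedK.
Qed.

Lemma pprojZ a x : pproj (a *: x) = pscale a (pproj x).
Proof.
apply/pproj_eq; rewrite -scalerBr -[X in spanned X]addr0.
by apply: spanned_comb; [apply: spannedK|apply: spanned_submodule.1].
Qed.

Lemma paddA : associative padd.
Proof.
move=> x y z; rewrite -[x]pprojK -[y]pprojK -[z]pprojK.
by rewrite -!padd_proj addrA.
Qed.

Lemma paddC : commutative padd.
Proof. by move=> x y; rewrite /padd addrC. Qed.

Lemma padd0 : left_id (pproj 0) padd.
Proof. by move=> x; rewrite -[x]pprojK -padd_proj add0r. Qed.

Definition popp (x : presented) : presented := pproj (- prepr x).

Lemma paddN : left_inverse (pproj 0) popp padd.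
Proof.
by move=> x; rewrite /popp -[X in padd _ X]pprojK -padd_proj addNr.
Qed.

HB.instance Definition _ := GRing.isZmodule.Build presented paddA paddC padd0 paddN.

Lemma pprojD x y : pproj (x + y) = pproj x + pproj y.
Proof. exact: padd_proj. Qed.

Lemma pscaleA a b x : pscale a (pscale b x) = pscale (a * b) x.
Proof. by rewrite -[x]pprojK -!pprojZ scalerA. Qed.

Lemma pscale1 : left_id 1 pscale.
Proof. by move=> x; rewrite -[x]pprojK -pprojZ scale1r. Qed.

Lemma pscaleDr : right_distributive pscale +%R.
Proof.
move=> a x y; rewrite -[x]pprojK -[y]pprojK.
by rewrite -pprojD -!pprojZ scalerDr pprojD.
Qed.

Lemma pscaleDl x : {morph pscale^~ x : a b / a + b}.
Proof. by move=> a b; rewrite -[x]pprojK -!pprojZ scalerDl pprojD. Qed.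

HB.instance Definition _ := GRing.Zmodule_isLmodule.Build k presented
  pscaleA pscale1 pscaleDr pscaleDl.

Lemma pproj_linear : linear pproj.
Proof. by move=> a x y; rewrite pprojD pprojZ. Qed.

HB.instance Definition _ := GRing.isLinear.Build k F presented _ pproj pproj_linear.

Definition pgen (x : X) : presented :=
  locked_with seal_key (fun x => pproj << x >>) x.

Lemma pgenE x : pgen x = pproj << x >>.
Proof. by rewrite /pgen locked_withE. Qed.

Lemma pproj_rel r : R r -> pproj r = 0.
Proof.
move=> hr; rewrite -[RHS](raddf0 pproj); apply/pproj_eq.
by rewrite subr0; apply: spanned_rel.
Qed.

Lemma malg_expand (g : F) : g = \sum_(x <- msupp g) g@_x *: << x >>.
Proof.
rewrite {1}[g]monalgE; apply: eq_bigr => x _.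

by apply/malgP => y; rewrite mcoeffZ !mcoeffU mulrnAr mulr1.
Qed.

Lemma presented_ind (S : presented -> Prop) :
  S 0 -> (forall a x y, S x -> S y -> S (a *: x + y)) ->
  (forall x, S (pgen x)) -> forall x, S x.
Proof.
move=> S0 SD Sg x; rewrite -[x]pprojK [prepr x]malg_expand.
elim: (enum_fset _) => [|y s ih]; first by rewrite big_nil raddf0; exact: S0.
by rewrite big_cons pproj_linear; apply: SD; [rewrite -pgenE; exact: Sg|].
Qed.

Section Lift.
Variables (W : lmodType k) (f : X -> W).

Definition mext (g : F) : W := \sum_(x <- msupp g) g@_x *: f x.

Lemma mextw (D : {fset X}) (g : F) : (msupp g `<=` D)%fset ->
  mext g = \sum_(x <- D) g@_x *: f x.
Proof.
move=> hD; rewrite /mext (big_fset_incl _ hD) //= => x _ hx.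
by rewrite mcoeff_outdom // scale0r.
Qed.

Lemma mext_linear : linear mext.
Proof.
move=> a x y; pose D := (msupp x `|` msupp y)%fset.
rewrite (@mextw D x) ?fsubsetUl // (@mextw D y) ?fsubsetUr //.
rewrite (@mextw D) => [|]; last first.
  apply: fsubset_trans (msuppD_le _ _) _.
  by apply: fsetSU; apply: msuppZ_le.
rewrite scaler_sumr -big_split; apply: eq_bigr => z _ /=.
by rewrite mcoeffD mcoeffZ scalerDl scalerA.
Qed.

HB.instance Definition _ := GRing.isLinear.Build k F W _ mext mext_linear.

Lemma mextU x : mext << x >> = f x.
Proof.
by rewrite (@mextw [fset x]%fset) ?msuppU_le // big_seq_fset1 mcoeffUU scale1r.
Qed.

Lemma mext_lin_rel a x y z :
  mext (<< z >> - (a *: << x >> + << y >>)) = f z - (a *: f x + f y).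
Proof.
have -> : << z >> - (a *: << x >> + << y >>)
    = -1 *: (a *: << x >> + << y >>) + << z >> :> F by rewrite scaleN1r addrC.
by rewrite !mext_linear !mextU scaleN1r addrC.
Qed.

Definition respects := forall r, R r -> mext r = 0.

Definition plift (x : presented) : W :=
  locked_with seal_key (fun x => mext (prepr x)) x.

Hypothesis hf : respects.

Lemma plift_pproj g : plift (pproj g) = mext g.
Proof.
apply/eqP; rewrite -subr_eq0 /plift unlock -raddfB; apply/eqP.
have: spanned (prepr (pproj g) - g) by apply/pproj_eq; rewrite pprojK.
move/(_ (fun u => mext u = 0)); apply => //; split=> [|a u v hu hv].
  exact: raddf0.
by rewrite mext_linear hu hv scaler0 addr0.
Qed.

Lemma plift_gen x : plift (pgen x) = f x.
Proof. by rewrite pgenE plift_pproj mextU. Qed.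

Lemma plift_linear : linear plift.
Proof.
move=> a x y; rewrite -[x]pprojK -[y]pprojK -linearP !plift_pproj.
exact: linearP.
Qed.

End Lift.

Lemma eq_plift (W : lmodType k) (f g : X -> W) : f =1 g -> plift f =1 plift g.
Proof.
by move=> h x; rewrite /plift !unlock; apply: eq_bigr => y _; rewrite h.
Qed.

End Presentation.

Section BilinearLift.
Variables (k : fieldType) (X Y : choiceType).
Variables (R : {malg k[X]} -> Prop) (T : {malg k[Y]} -> Prop) (W : lmodType k).
Variable f : X -> Y -> W.
Hypothesis hfl : forall y, respects R (f^~ y).
Hypothesis hfr : forall x, respects T (f x).

Definition plift2 (x : presented R) (y : presented T) : W :=
  locked_with seal_key (fun x y => plift (fun a => plift (f a) y) x) x y.

Lemma plift2_respects y : respects R (fun a => plift (f a : Y -> W) (y : presented T)).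
Proof.
move=> r hr; rewrite -[y]pprojK /mext.
elim/(@presented_ind _ _ T): (pproj T (prepr y)) => [|a u v hu hv|b].
- by rewrite big1 // => x _; rewrite -(raddf0 (pproj T)) plift_pproj // raddf0 scaler0.
- under eq_bigr do rewrite (plift_linear (hfr _)) scalerDr scalerA mulrC -scalerA.
  by rewrite big_split -scaler_sumr /= hu hv scaler0 addr0.
- by under eq_bigr do rewrite plift_gen //; exact: hfl.
Qed.

Lemma plift2_linl y : linear (plift2^~ y).
Proof.
by move=> a u v; rewrite /plift2 !unlock; apply: plift_linear (plift2_respects y) _ _ _.
Qed.

Lemma plift2_linr x : linear (plift2 x).
Proof.
move=> a u v; rewrite {1 2 3}/plift2 !unlock.
rewrite (eq_plift (fun b => plift_linear (hfr b) a u v)).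
by rewrite /plift !unlock /mext scaler_sumr -big_split; apply: eq_bigr => z _ /=;
  rewrite scalerDr scalerA mulrC -scalerA.
Qed.

Lemma plift2_gen x y : plift2 (pgen R x) (pgen T y) = f x y.
Proof. by rewrite /plift2 unlock plift_gen ?plift_gen //; exact: plift2_respects. Qed.

End BilinearLift.

(* Words over an alphabet L whose letters belong to one or several vector
   spaces: comb a x y z says that x, y, z lie in the same space, z = a x + y. *)
Section Words.
Variables (k : fieldType) (L : choiceType).
Variables (comb : k -> L -> L -> L -> Prop) (P : pred (seq L)).
Local Notation X := {s : seq L | P s}.

Inductive multilinear_rel : {malg k[X]} -> Prop :=
  MultilinearRel (x y z : X) (a : k) (s t : seq L) (l1 l2 l3 : L) of
    comb a l1 l2 l3 & val x = s ++ l1 :: t & val y = s ++ l2 :: t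
    & val z = s ++ l3 :: t :
  multilinear_rel (<< z >> - (a *: << x >> + << y >>)).

(* The direct sum, over the shapes of the words allowed by P, of the tensor
   products of the spaces of letters. *)
Definition word_space : Type := presented multilinear_rel.
HB.instance Definition _ := GRing.Lmodule.on word_space.

(* The pure tensor of the letters of s (and 0 if s is not allowed by P). *)
Definition word (s : seq L) : word_space :=
  locked_with seal_key
    (fun s => if insub s is Some x then pgen multilinear_rel x else 0) s.

Definition multilinear (W : lmodType k) (f : seq L -> W) : Prop :=
  forall a s t l1 l2 l3, comb a l1 l2 l3 ->
    P (s ++ l1 :: t) -> P (s ++ l2 :: t) -> P (s ++ l3 :: t) ->
    f (s ++ l3 :: t) = a *: f (s ++ l1 :: t) + f (s ++ l2 :: t).

Lemma word_val (x : X) : word (val x) = pgen multilinear_rel x.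
Proof. by rewrite /word unlock valK. Qed.

Lemma wordN s : ~~ P s -> word s = 0.
Proof. by move=> h; rewrite /word unlock insubN. Qed.

Lemma word_multilinear : multilinear word.
Proof.
move=> a s t l1 l2 l3 hl h1 h2 h3; apply/eqP; rewrite -subr_eq0; apply/eqP.
pose X1 : X := exist (fun s => is_true (P s)) _ h1; pose X2 : X := exist (fun s => is_true (P s)) _ h2.
pose X3 : X := exist (fun s => is_true (P s)) _ h3.
rewrite (word_val X1) (word_val X2) (word_val X3).
rewrite !pgenE -(pproj_linear multilinear_rel) -(raddfB (pproj multilinear_rel)).
by apply: pproj_rel; apply: MultilinearRel hl _ _ _.
Qed.

Lemma word_ind (S : word_space -> Prop) :
  S 0 -> (forall a x y, S x -> S y -> S (a *: x + y)) ->
  (forall s, P s -> S (word s)) -> forall x, S x.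
Proof.
move=> S0 SD Sw; apply: presented_ind => // x.
by rewrite -word_val; apply: Sw; apply: valP.
Qed.

Lemma multilinear_respects (W : lmodType k) (f : seq L -> W) :
  multilinear f -> respects multilinear_rel (f \o val).
Proof.
move=> hf _ [x y z a s t l1 l2 l3 hl hx hy hz].
rewrite mext_lin_rel /= hx hy hz (hf _ _ _ _ _ _ hl) ?subrr //.
- by rewrite -hx; apply: valP.
- by rewrite -hy; apply: valP.
- by rewrite -hz; apply: valP.
Qed.

Definition wlift_fun (W : lmodType k) (f : seq L -> W) : word_space -> W :=
  plift (f \o val).

Lemma wlift_linear (W : lmodType k) (f : seq L -> W) :
  multilinear f -> linear (wlift_fun f).
Proof. by move=> hf; apply: plift_linear; apply: multilinear_respects. Qed.

Definition wlift (W : lmodType k) (f : seq L -> W) (hf : multilinear f) :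
    {linear word_space -> W} :=
  locked_with seal_key (HB.pack (wlift_fun f)
    (GRing.isLinear.Build k word_space W *:%R (wlift_fun f) (wlift_linear hf))
      : {linear word_space -> W}).

Lemma wlift_word (W : lmodType k) (f : seq L -> W) (hf : multilinear f) s :
  P s -> wlift hf (word s) = f s.
Proof.
move=> hs; rewrite (word_val (exist (fun s => is_true (P s)) s hs)) /wlift locked_withE /= /wlift_fun plift_gen //.
exact: multilinear_respects.
Qed.

Lemma eq_word_linear (W : lmodType k) (f g : {linear word_space -> W}) :
  (forall s, P s -> f (word s) = g (word s)) -> f =1 g.
Proof.
move=> h; apply: word_ind => [|a x y hx hy|s /h //]; first by rewrite !raddf0.
by rewrite !linearP hx hy.
Qed.

End Words.

Section WordsBilinear.
Variables (k : fieldType) (L M : choiceType).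
Variables (cL : k -> L -> L -> L -> Prop) (PL : pred (seq L)).
Variables (cM : k -> M -> M -> M -> Prop) (PM : pred (seq M)).
Variables (W : lmodType k) (f : seq L -> seq M -> W).
Hypothesis hfl : forall t, PM t -> multilinear cL PL (f^~ t).
Hypothesis hfr : forall s, PL s -> multilinear cM PM (f s).

Definition wlift2 (x : word_space cL PL) (y : word_space cM PM) : W :=
  plift2 (fun a b => f (val a) (val b)) x y.

Let resl (b : {t : seq M | PM t}) :
  respects (@multilinear_rel k L cL PL) (fun a => f (val a) (val b)).
Proof. exact: (multilinear_respects (hfl (valP b))). Qed.

Let resr (a : {s : seq L | PL s}) :
  respects (@multilinear_rel k M cM PM) (fun b => f (val a) (val b)).
Proof. exact: (multilinear_respects (hfr (valP a))). Qed.

Lemma wlift2_linl y : linear (wlift2^~ y).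
Proof. exact: (plift2_linl resl resr). Qed.

Lemma wlift2_linr x : linear (wlift2 x).
Proof. exact: (plift2_linr resr). Qed.

Lemma wlift2_word s t :
  PL s -> PM t -> wlift2 (word cL PL s) (word cM PM t) = f s t.
Proof.
move=> hs ht; rewrite (word_val _ (exist (fun s => is_true (PL s)) s hs)).
rewrite (word_val _ (exist (fun s => is_true (PM s)) t ht)).
exact: (plift2_gen resl resr).
Qed.

End WordsBilinear.

Section TensorAlgebra.
Variables (k : fieldType) (V : lmodType k).

Definition lin_comb (a : k) (x y z : V) : Prop := z = a *: x + y.

Definition nonnil (s : seq V) : bool := s != [::].

(* T(V), the direct sum of the V^{(x) n}, n > 0. *)
Definition tpos : Type := word_space lin_comb nonnil.
HB.instance Definition _ := GRing.Lmodule.on tpos.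

(* The unital tensor algebra of V: the direct sum of the V^{(x) n}, n >= 0. *)
Definition tbar : Type := word_space lin_comb predT.
HB.instance Definition _ := GRing.Lmodule.on tbar.

Definition tword (s : seq V) : tpos := word lin_comb nonnil s.
Definition bword (s : seq V) : tbar := word lin_comb predT s.

Lemma bword_multilinear : multilinear lin_comb predT bword.
Proof. exact: word_multilinear. Qed.

Lemma bcat_multilinearl t : multilinear lin_comb predT (fun s => bword (s ++ t)).
Proof.
by move=> a s u l1 l2 l3 h _ _ _; rewrite -!catA; apply: bword_multilinear.
Qed.

Lemma bcat_multilinearr s : multilinear lin_comb predT (fun t => bword (s ++ t)).
Proof.
by move=> a t u l1 l2 l3 h _ _ _; rewrite !catA; apply: bword_multilinear.
Qed.

Definition bmul (x y : tbar) : tbar := wlift2 (fun s t => bword (s ++ t)) x y.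

Lemma bmul_linl y : linear (bmul^~ y).
Proof.
apply: wlift2_linl => ? _;
  [exact: bcat_multilinearl|exact: bcat_multilinearr].
Qed.

Lemma bmul_linr x : linear (bmul x).
Proof. by apply: wlift2_linr => ? _; exact: bcat_multilinearr. Qed.

Lemma bmul_word s t : bmul (bword s) (bword t) = bword (s ++ t).
Proof.
apply: (@wlift2_word k V V lin_comb predT lin_comb predT) => // ? _;
  [exact: bcat_multilinearl|exact: bcat_multilinearr].
Qed.

Lemma lin0 (U W : lmodType k) (f : U -> W) : linear f -> f 0 = 0.
Proof. by move=> h; have := h (-1) 0 0; rewrite scaler0 addr0 scaleN1r addNr. Qed.

Lemma linZ (U W : lmodType k) (f : U -> W) : linear f -> forall a x, f (a *: x) = a *: f x.
Proof. by move=> h a x; have := h a x 0; rewrite addr0 (lin0 h) addr0. Qed.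

Lemma linD (U W : lmodType k) (f : U -> W) : linear f -> {morph f : x y / x + y}.
Proof. by move=> h x y; have := h 1 x y; rewrite !scale1r. Qed.

Lemma bword_ind (S : tbar -> Prop) :
  S 0 -> (forall a x y, S x -> S y -> S (a *: x + y)) ->
  (forall s, S (bword s)) -> forall x, S x.
Proof. by move=> S0 SD Sw; apply: word_ind => // s _; apply: Sw. Qed.

Lemma bmulA : associative bmul.
Proof.
move=> x y z; elim/bword_ind: x => [|a x x' hx hx'|s].
- by rewrite !(lin0 (bmul_linl _)).
- by rewrite !(bmul_linl _ a x x') hx hx' (bmul_linl _ a).
elim/bword_ind: y => [|a x x' hx hx'|t].
- by rewrite (lin0 (bmul_linl z)) !(lin0 (bmul_linr _)) (lin0 (bmul_linl z)).
- rewrite (bmul_linl z a x x') !(bmul_linr (bword s) a) hx hx'.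
  by rewrite (bmul_linl z a).
elim/bword_ind: z => [|a x x' hx hx'|u].
- by rewrite !(lin0 (bmul_linr _)).
- by rewrite !(bmul_linr _ a x x') (bmul_linr (bword s) a) hx hx'.
by rewrite !bmul_word catA.
Qed.

Lemma bmul1l : left_id (bword [::]) bmul.
Proof.
elim/bword_ind => [|a x x' hx hx'|s]; first by rewrite (lin0 (bmul_linr _)).
  by rewrite (bmul_linr _ a x x') hx hx'.
by rewrite bmul_word.
Qed.

Lemma bmul1r : right_id (bword [::]) bmul.
Proof.
elim/bword_ind => [|a x x' hx hx'|s]; first by rewrite (lin0 (bmul_linl _)).
  by rewrite (bmul_linl _ a x x') hx hx'.
by rewrite bmul_word cats0.
Qed.

Lemma bmulDl : left_distributive bmul +%R.
Proof. by move=> x y z; apply: linD (bmul_linl z) _ _. Qed.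

Lemma bmulDr : right_distributive bmul +%R.
Proof. by move=> x y z; apply: linD (bmul_linr x) _ _. Qed.

Definition baug_fun (s : seq V) : k^o := if s is [::] then 1 else 0.

Lemma baug_multilinear : multilinear lin_comb predT baug_fun.
Proof. by move=> a [|x s] t l1 l2 l3 _ _ _ _ /=; rewrite scaler0 addr0. Qed.

Lemma bone_neq0 : bword [::] != 0.
Proof.
apply/eqP => h; have := wlift_word baug_multilinear (s := [::]) isT.
by rewrite -/(bword [::]) h raddf0 => /esym/eqP; rewrite oner_eq0.
Qed.

HB.instance Definition _ := GRing.Zmodule_isNzRing.Build tbar
  bmulA bmul1l bmul1r bmulDl bmulDr bone_neq0.

Lemma bmul_scalerAl (a : k) (x y : tbar) : a *: (x * y) = (a *: x) * y.
Proof. by rewrite -[RHS]/(bmul (a *: x) y) (linZ (bmul_linl y)). Qed.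

Lemma bmul_scalerAr (a : k) (x y : tbar) : a *: (x * y) = x * (a *: y).
Proof. by rewrite -[RHS]/(bmul x (a *: y)) (linZ (bmul_linr x)). Qed.

HB.instance Definition _ := GRing.Lmodule_isLalgebra.Build k tbar bmul_scalerAl.
HB.instance Definition _ := GRing.Lalgebra_isAlgebra.Build k tbar bmul_scalerAr.

Lemma bwordM s t : bword s * bword t = bword (s ++ t).
Proof. exact: bmul_word. Qed.

Lemma bword0 : bword [::] = 1.
Proof. by []. Qed.

Section AlgebraLift.
Variables (B : algType k) (g : {linear V -> B}).

Definition blift_fun (s : seq V) : B := \prod_(v <- s) g v.

Lemma blift_multilinear : multilinear lin_comb predT blift_fun.
Proof.
move=> a s t l1 l2 l3 -> _ _ _; rewrite /blift_fun !big_cat !big_cons /=.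
by rewrite linearP mulrDl mulrDr -scalerAl -scalerAr.
Qed.

Definition blift_lin : {linear tbar -> B} := wlift blift_multilinear.

Lemma blift_word s : blift_lin (bword s) = \prod_(v <- s) g v.
Proof. exact: wlift_word. Qed.

Lemma blift_monoid_morphism : monoid_morphism blift_lin.
Proof.
split=> [|x y]; first by rewrite -bword0 blift_word big_nil.
elim/bword_ind: x => [|a x x' hx hx'|s].
- by rewrite mul0r raddf0 mul0r.
- by rewrite mulrDl -scalerAl !linearP hx hx' mulrDl -scalerAl.
elim/bword_ind: y => [|a x x' hx hx'|t].
- by rewrite mulr0 raddf0 mulr0.
- by rewrite mulrDr -scalerAr !linearP hx hx' mulrDr -scalerAr.
by rewrite bwordM !blift_word big_cat.
Qed.

Definition blift : {lrmorphism tbar -> B} :=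
  locked_with seal_key (HB.pack (blift_lin : tbar -> B)
    (GRing.Linear.class blift_lin)
    (GRing.isMonoidMorphism.Build tbar B blift_lin blift_monoid_morphism)
      : {lrmorphism tbar -> B}).

Lemma bliftE s : blift (bword s) = \prod_(v <- s) g v.
Proof. by rewrite /blift locked_withE; exact: blift_word. Qed.

End AlgebraLift.

End TensorAlgebra.

Section TensorProduct.
Variables (k : fieldType) (U V : lmodType k).

Inductive tens_rel : {malg k[(U * V)%type]} -> Prop :=
| TensRelL a u u' v :
    tens_rel (<< (a *: u + u', v) >> - (a *: << (u, v) >> + << (u', v) >>))
| TensRelR a u v v' :
    tens_rel (<< (u, a *: v + v') >> - (a *: << (u, v) >> + << (u, v') >>)).

Definition tens : Type := presented tens_rel.
HB.instance Definition _ := GRing.Lmodule.on tens.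

Definition tpure (u : U) (v : V) : tens := pgen tens_rel (u, v).

Lemma tpure_linl v : linear (tpure^~ v).
Proof.
move=> a x y; apply/eqP; rewrite -subr_eq0; apply/eqP.
rewrite /tpure !pgenE -(pproj_linear tens_rel) -(raddfB (pproj tens_rel)).
by apply: pproj_rel; apply: TensRelL.
Qed.

Lemma tpure_linr u : linear (tpure u).
Proof.
move=> a x y; apply/eqP; rewrite -subr_eq0; apply/eqP.
rewrite /tpure !pgenE -(pproj_linear tens_rel) -(raddfB (pproj tens_rel)).
by apply: pproj_rel; apply: TensRelR.
Qed.

Lemma tens_ind (S : tens -> Prop) :
  S 0 -> (forall a x y, S x -> S y -> S (a *: x + y)) ->
  (forall u v, S (tpure u v)) -> forall x, S x.
Proof. by move=> S0 SD Sg; apply: presented_ind => // -[u v]; apply: Sg. Qed.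

Section Lift.
Variables (W : lmodType k) (f : U -> V -> W).
Hypothesis hl : forall v, linear (f^~ v).
Hypothesis hr : forall u, linear (f u).

Lemma tens_respects : respects tens_rel (fun p => f p.1 p.2).
Proof.
move=> _ [a u u' v|a u v v']; rewrite mext_lin_rel /=.
  by rewrite (hl v a u u') subrr.
by rewrite (hr u a v v') subrr.
Qed.

Definition tlift_fun : tens -> W := plift (fun p => f p.1 p.2).

Lemma tlift_linear : linear tlift_fun.
Proof. exact: plift_linear tens_respects. Qed.

Definition tlift : {linear tens -> W} :=
  locked_with seal_key (HB.pack tlift_fun
    (GRing.isLinear.Build k tens W *:%R tlift_fun tlift_linear)
      : {linear tens -> W}).

Lemma tlift_pure u v : tlift (tpure u v) = f u v.
Proof.
by rewrite /tlift locked_withE; exact: (plift_gen tens_respects).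
Qed.

End Lift.

End TensorProduct.

Section TensorForms.
Variables (k : fieldType) (U V : lmodType k).
Variables (f : {linear U -> k^o}) (g : {linear V -> k^o}).

Definition fmul (u : U) (v : V) : k^o := (f u : k) * (g v : k).

Lemma fmul_linl v : linear (fmul^~ v).
Proof. by move=> a x y; rewrite /fmul linearP mulrDl; congr (_ + _); rewrite -[RHS]/(a * _) mulrA. Qed.

Lemma fmul_linr u : linear (fmul u).
Proof. by move=> a x y; rewrite /fmul linearP mulrDr; congr (_ + _); rewrite -[RHS]/(a * _) mulrCA. Qed.

(* m_k o (f (x) g) *)
Definition tform : {linear tens U V -> k^o} := tlift fmul_linl fmul_linr.

Lemma tform_pure u v : tform (tpure u v) = (f u : k) * (g v : k).
Proof. exact: tlift_pure. Qed.

End TensorForms.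

Section TensorAlgebras.
Variables (k : fieldType) (A B : algType k).
Local Notation T := (tens A B).
Local Notation gen := (pgen (@tens_rel k A B)).

Definition tmul_gen (p q : A * B) : T := tpure (p.1 * q.1) (p.2 * q.2).

Definition tmul (x y : T) : T := plift2 tmul_gen x y.

Lemma tmul_respectsl q : respects (@tens_rel k A B) (tmul_gen^~ q).
Proof.
apply: (tens_respects (f := fun a b => tpure (a * q.1) (b * q.2))) => [v|u] a x y.
  by rewrite mulrDl -scalerAl tpure_linl.
by rewrite mulrDl -scalerAl tpure_linr.
Qed.

Lemma tmul_respectsr p : respects (@tens_rel k A B) (tmul_gen p).
Proof.
apply: (tens_respects (f := fun a b => tpure (p.1 * a) (p.2 * b))) => [v|u] a x y.
  by rewrite mulrDr -scalerAr tpure_linl.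
by rewrite mulrDr -scalerAr tpure_linr.
Qed.

Lemma tmul_linl y : linear (tmul^~ y).
Proof. exact: plift2_linl tmul_respectsl tmul_respectsr y. Qed.

Lemma tmul_linr x : linear (tmul x).
Proof. exact: plift2_linr tmul_respectsr x. Qed.

Lemma tmul_pure a b a' b' :
  tmul (tpure a b) (tpure a' b') = tpure (a * a') (b * b').
Proof. exact: (plift2_gen tmul_respectsl tmul_respectsr). Qed.

Lemma tmulA : associative tmul.
Proof.
move=> x y z; elim/tens_ind: x => [|a x x' hx hx'|u u'].
- by rewrite !(lin0 (tmul_linl _)).
- by rewrite !(tmul_linl _ a x x') hx hx' (tmul_linl _ a).
elim/tens_ind: y => [|a x x' hx hx'|v v'].
- by rewrite (lin0 (tmul_linl z)) !(lin0 (tmul_linr _)) (lin0 (tmul_linl z)).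
- rewrite (tmul_linl z a x x') !(tmul_linr (tpure u u') a) hx hx'.
  by rewrite (tmul_linl z a).
elim/tens_ind: z => [|a x x' hx hx'|w w'].
- by rewrite !(lin0 (tmul_linr _)).
- by rewrite !(tmul_linr _ a x x') (tmul_linr (tpure u u') a) hx hx'.
by rewrite !tmul_pure !mulrA.
Qed.

Lemma tmul1l : left_id (tpure 1 1) tmul.
Proof.
elim/tens_ind => [|a x x' hx hx'|u v]; first by rewrite (lin0 (tmul_linr _)).
  by rewrite (tmul_linr _ a x x') hx hx'.
by rewrite tmul_pure !mul1r.
Qed.

Lemma tmul1r : right_id (tpure 1 1) tmul.
Proof.
elim/tens_ind => [|a x x' hx hx'|u v]; first by rewrite (lin0 (tmul_linl _)).
  by rewrite (tmul_linl _ a x x') hx hx'.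
by rewrite tmul_pure !mulr1.
Qed.

Lemma tmulDl : left_distributive tmul +%R.
Proof. by move=> x y z; apply: linD (tmul_linl z) _ _. Qed.

Lemma tmulDr : right_distributive tmul +%R.
Proof. by move=> x y z; apply: linD (tmul_linr x) _ _. Qed.

End TensorAlgebras.

Section DoubleTensor.
Variables (k : fieldType) (V : lmodType k).

Local Notation dbar := (tbar (tpos V)).

(* The bar word w_1 | ... | w_m, for nonempty words w_i. *)
Definition dword (ws : seq (seq V)) : dbar := bword [seq tword w | w <- ws].

Definition counit : {lrmorphism dbar -> k^o} :=
  blift (\0 : {linear tpos V -> k^o}).

Local Notation dtens := (tens dbar dbar).

Lemma dtens_one_neq0 : (tpure 1 1 : dtens) != 0.
Proof.
apply/eqP => h; have := tform_pure counit counit 1 1.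
by rewrite h raddf0 !rmorph1 mulr1 => /esym/eqP; rewrite oner_eq0.
Qed.

Definition dmul (x y : dtens) : dtens := @tmul k dbar dbar x y.

HB.instance Definition _ := @GRing.Zmodule_isNzRing.Build dtens 
  (tpure 1 1 : dtens) dmul
  (@tmulA k dbar dbar) (@tmul1l k dbar dbar) (@tmul1r k dbar dbar)
  (@tmulDl k dbar dbar) (@tmulDr k dbar dbar) dtens_one_neq0.

Lemma dtens_scalerAl (a : k) (x y : dtens) : a *: (x * y) = (a *: x) * y.
Proof. exact/esym/(linZ (@tmul_linl k dbar dbar y)). Qed.

Lemma dtens_scalerAr (a : k) (x y : dtens) : a *: (x * y) = x * (a *: y).
Proof. exact/esym/(linZ (@tmul_linr k dbar dbar x)). Qed.

HB.instance Definition _ := GRing.Lmodule_isLalgebra.Build k dtens dtens_scalerAl.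
HB.instance Definition _ := GRing.Lalgebra_isAlgebra.Build k dtens dtens_scalerAr.

Lemma dtens_mul (a b c d : dbar) :
  (tpure a b : dtens) * (tpure c d : dtens) = tpure (a * c) (b * d).
Proof. exact: tmul_pure. Qed.

End DoubleTensor.

Section Cutting.
Variable T : Type.

(* Cut s at the positions marked by m, dropping the marked letters. *)
Fixpoint pieces (m : seq bool) (s : seq T) : seq (seq T) :=
  match m, s with
  | b :: m', x :: s' =>
      if b then [::] :: pieces m' s'
      else (x :: head [::] (pieces m' s')) :: behead (pieces m' s')
  | _, _ => [:: [::]]
  end.

Definition nonempty (ws : seq (seq T)) : seq (seq T) :=
  [seq w <- ws | ~~ nilp w].

(* A subset S of [n] is given by its characteristic sequence m, so that a_S is
   mask m a; the words a_{J_1}, ..., a_{J_l} on the maximal intervals of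
   [n] \ S are the nonempty pieces. *)
Definition gaps (m : seq bool) (s : seq T) : seq (seq T) := nonempty (pieces m s).

Lemma mask_pieces_true m1 m2 s t :
  size m1 = size s ->
  (exists l r, forall z, mask (m1 ++ true :: m2) (s ++ z :: t) = l ++ z :: r) /\
  (exists G, forall z, pieces (m1 ++ true :: m2) (s ++ z :: t) = G).
Proof.
move=> h; split.
  by exists (mask m1 s), (mask m2 t) => z; rewrite mask_cat.
elim: s m1 h => [|x s ih] [|b m1] //= h; first by eexists=> z; reflexivity.
case: h => h; have [G hG] := ih _ h; eexists => z; by rewrite hG; reflexivity.
Qed.

Lemma mask_pieces_false m1 m2 s t :
  size m1 = size s ->
  (exists M, forall z, mask (m1 ++ false :: m2) (s ++ z :: t) = M) /\
  (exists L l r R, forall z,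
     pieces (m1 ++ false :: m2) (s ++ z :: t) = L ++ (l ++ z :: r) :: R).
Proof.
move=> h; split.
  by exists (mask m1 s ++ mask m2 t) => z; rewrite mask_cat.
elim: s m1 h => [|x s ih] [|b m1] //= h.
  by exists [::], [::]; do 2!eexists; move=> z; reflexivity.
case: h => h; have [L [l [r [R hG]]]] := ih _ h; case: b.
  by exists ([::] :: L), l, r, R => z; rewrite hG.
case: L hG => [|p L] hG.
  by exists [::], (x :: l), r, R => z; rewrite hG.
by exists ((x :: p) :: L), l, r, R => z; rewrite hG.
Qed.

End Cutting.

Section Coproduct.
Variables (k : fieldType) (V : lmodType k).
Local Notation H := (tbar (tpos V)).
Local Notation HH := (tens H H).

Lemma dword_lin a (x y : V) L l r R :
  dword (L ++ (l ++ (a *: x + y) :: r) :: R) =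
  a *: dword (L ++ (l ++ x :: r) :: R) + dword (L ++ (l ++ y :: r) :: R) :> H.
Proof.
rewrite /dword !map_cat /=; apply: bword_multilinear => //.
by apply: word_multilinear => //; case: l.
Qed.

(* The term a_S (x) a_{J^S} of the coproduct of the word s. *)
Definition cut (m : seq bool) (s : seq V) : HH :=
  tpure (dword (nonempty [:: mask m s])) (dword (gaps m s)).

Definition delta_fun (P : pred (seq bool)) (s : seq V) : HH :=
  \sum_(m : (size s).-tuple bool | P m) cut m s.

Lemma cut_lin m a (x y : V) s t : size m = (size s + (size t).+1)%N ->
  cut m (s ++ (a *: x + y) :: t) =
  a *: cut m (s ++ x :: t) + cut m (s ++ y :: t).
Proof.
move=> hm; have hs : size (take (size s) m) = size s.
  by apply: size_takel; rewrite hm leq_addr.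
have : m = take (size s) m ++ nth false m (size s) :: drop (size s).+1 m.
  rewrite -drop_nth ?cat_take_drop // hm.
  by rewrite addnS ltnS leq_addr.
move: (take _ _) (drop _ _) hs => m1 m2 hs.
have nz l z (r : seq V) : nilp (l ++ z :: r) = false by case: l.
case: (nth _ _ _) => ->; rewrite /cut /gaps.
  have [[l [r hM]] [G hG]] := mask_pieces_true m2 t hs.
  rewrite !hM !hG /nonempty /= !nz /=.
  by rewrite (dword_lin a x y [::] l r [::]) tpure_linl.
have [[M hM] [L [l [r [R hG]]]]] := mask_pieces_false m2 t hs.
rewrite !hM !hG /nonempty !filter_cat /= !nz /=.
by rewrite dword_lin tpure_linr.
Qed.

Lemma delta_multilinear P : multilinear (@lin_comb k V) (@nonnil k V) (delta_fun P).
Proof.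
move=> a s t x y z -> _ _ _; rewrite /delta_fun !size_cat /=.
rewrite scaler_sumr -big_split; apply: eq_bigr => m _.
by apply: cut_lin; rewrite size_tuple.
Qed.

(* The part of the coproduct on T(V) indexed by the subsets satisfying P. *)
Definition delta (P : pred (seq bool)) : {linear tpos V -> HH} :=
  wlift (delta_multilinear P).

Lemma delta_word P s : s != [::] ->
  delta P (tword s) = \sum_(m : (size s).-tuple bool | P m) cut m s.
Proof. exact: wlift_word. Qed.

Definition Delta : {lrmorphism H -> HH} := blift (delta predT).

Definition Delta_half_fun (P : pred (seq bool)) (ts : seq (tpos V)) : HH :=
  if ts is t :: ts' then delta P t * Delta (bword ts') else 0.

Lemma Delta_half_multilinear P :
  multilinear (@lin_comb k (tpos V)) predT (Delta_half_fun P).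
Proof.
move=> a [|w s] t x y z -> _ _ _ /=.
  by rewrite linearP mulrDl -scalerAl.
rewrite (@bword_multilinear k (tpos V) a s t x y (a *: x + y)) //.
by rewrite linearP mulrDr -scalerAr.
Qed.

(* The formula concerns bar words w_1 | ... | w_m with m > 0; the value at 1
   is set to 0. *)
Definition Delta_half (P : pred (seq bool)) : {linear H -> HH} :=
  wlift (Delta_half_multilinear P).

Definition Delta_prec_plus : {linear H -> HH} := Delta_half (head false).
Definition Delta_succ_plus : {linear H -> HH} :=
  Delta_half (fun m => ~~ head false m).

Definition red (x : H) : H := x - (counit V x : k) *: 1.

Definition Delta_prec (x : H) : HH := Delta_prec_plus x - tpure (red x) 1.
Definition Delta_succ (x : H) : HH := Delta_succ_plus x - tpure 1 (red x).

Lemma red_linear : linear red.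
Proof.
move=> a x y; rewrite /red linearP scalerDl -scalerA scalerBr opprD.
by rewrite addrACA.
Qed.
HB.instance Definition _ := GRing.isLinear.Build k H H _ red red_linear.

Lemma Delta_prec_linear : linear Delta_prec.
Proof.
move=> a x y; rewrite /Delta_prec linearP red_linear tpure_linl scalerBr opprD.
by rewrite addrACA.
Qed.
HB.instance Definition _ :=
  GRing.isLinear.Build k H HH _ Delta_prec Delta_prec_linear.

Lemma Delta_succ_linear : linear Delta_succ.
Proof.
move=> a x y; rewrite /Delta_succ linearP red_linear tpure_linr scalerBr opprD.
by rewrite addrACA.
Qed.
HB.instance Definition _ :=
  GRing.isLinear.Build k H HH _ Delta_succ Delta_succ_linear.

End Coproduct.

Section Forms.
Variables (k : fieldType) (V : lmodType k).
Local Notation H := (tbar (tpos V)).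
Local Notation form := {linear H -> k^o}.
Local Notation character := {lrmorphism H -> k^o}.

Section Convolution.
Variables f g : character.

Definition conv_lin : form := tform f g \o @Delta k V.

Lemma conv_monoid_morphism : monoid_morphism conv_lin.
Proof.
have tP (u v : H) : tform f g (tpure u v) = (f u : k) * (g v : k).
  exact: tform_pure.
have tM (x y : tens H H) : tform f g (x * y) = tform f g x * tform f g y.
  elim/tens_ind: x => [|a x x' hx hx'|u u'].
  - by rewrite mul0r raddf0 mul0r.
  - by rewrite mulrDl -scalerAl !linearP hx hx' mulrDl -scalerAl.
  elim/tens_ind: y => [|a x x' hx hx'|v v'].
  - by rewrite mulr0 raddf0 mulr0.
  - by rewrite mulrDr -scalerAr !linearP hx hx' mulrDr -scalerAr.
  by rewrite dtens_mul !tP !rmorphM; exact: mulrACA.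
split=> [|x y] /=; last by rewrite (rmorphM (Delta V) x y); exact: tM.
rewrite (rmorph1 (Delta V)).
by rewrite [LHS](tP 1 1) (rmorph1 f) (rmorph1 g) mulr1.
Qed.

(* f * g = m_k (f (x) g) Delta *)
Definition conv : character :=
  locked_with seal_key (HB.pack (conv_lin : H -> k^o)
    (GRing.Linear.class conv_lin)
    (GRing.isMonoidMorphism.Build H k^o conv_lin conv_monoid_morphism)
      : character).

Lemma convE x : conv x = tform f g (Delta V x).
Proof. by rewrite /conv locked_withE. Qed.

End Convolution.

Definition reduced (f : form) : form := f \o @red k V.

(* Every form is f(1) e + reduced f; the half-products of reduced forms are
   given by Delta_prec and Delta_succ, and extended bilinearly by
   e > f = f = f < e and e < f = 0 = f > e (with < and > for the left and right
   half-products). The undefined e < e and e > e are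
   set to 0; they never occur for forms one of which vanishes at 1. *)
Definition half_prec (f g : form) (x : H) : k :=
  tform (reduced f) (reduced g) (Delta_prec x) + (g 1 : k) * reduced f x.

Definition half_succ (f g : form) (x : H) : k :=
  tform (reduced f) (reduced g) (Delta_succ x) + (f 1 : k) * reduced g x.

(* The elements of g_H(k); H is the kernel of the augmentation. *)
Definition infinitesimal (f : form) : Prop :=
  f 1 = 0 /\ forall x y : H, counit V x = 0 -> counit V y = 0 -> f (x * y) = 0.

(* The element satisfying P; the default value d is irrelevant below, where P
   is always satisfied. *)
Definition the (T : Type) (d : T) (P : T -> Prop) : T :=
  if pselect (exists x, P x) is left h then projT1 (cid h) else d.

(* The solutions of Phi = e + alpha < Phi and Phi = e + Phi > alpha are unique
   among all linear forms and are characters, for alpha in g_H(k). *)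
Definition E_prec (alpha : form) : character :=
  the (counit V) (fun Phi : character =>
    forall x, Phi x = (counit V x : k) + half_prec alpha Phi x).

Definition E_succ (alpha : form) : character :=
  the (counit V) (fun Phi : character =>
    forall x, Phi x = (counit V x : k) + half_succ Phi alpha x).

(* The inverses of the bijections E_prec and E_succ from g_H(k) to G_H(k). *)
Definition L_prec (Phi : character) : form :=
  the (\0 : form) (fun alpha => infinitesimal alpha /\ E_prec alpha =1 Phi).

Definition L_succ (Phi : character) : form :=
  the (\0 : form) (fun alpha => infinitesimal alpha /\ E_succ alpha =1 Phi).

Definition box_prec (Phi Psi : character) : character :=
  E_prec (L_prec Phi \+ L_prec Psi).

Definition box_succ (Phi Psi : character) : character :=
  E_succ (L_succ Phi \+ L_succ Psi).

End Forms.

(* Associative, not necessarily unital, k-algebras. *)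
HB.mixin Record Lmodule_isNuAlg (k : fieldType) V of GRing.Lmodule k V := {
  nmul : V -> V -> V;
  nmulA : associative nmul;
  nmul_linl : forall y, linear (nmul^~ y);
  nmul_linr : forall x, linear (nmul x)
}.

#[short(type="nuAlgType")]
HB.structure Definition NuAlg (k : fieldType) :=
  {V of Lmodule_isNuAlg k V & GRing.Lmodule k V}.

Definition nprod (k : fieldType) (A : nuAlgType k) (x : A) (s : seq A) : A :=
  foldl nmul x s.

Section FreeProduct.
Variables (k : fieldType) (A1 A2 : nuAlgType k).
Local Notation L := (A1 + A2)%type.

Inductive letter_comb : k -> L -> L -> L -> Prop :=
| LetterComb1 a x y : letter_comb a (inl x) (inl y) (inl (a *: x + y))
| LetterComb2 a x y : letter_comb a (inr x) (inr y) (inr (a *: x + y)).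

Definition alternating (T1 T2 : Type) (w : seq (T1 + T2)) : bool :=
  sorted (fun x y => is_inl x != is_inl y) w.

Definition alt_word (w : seq L) : bool := (w != [::]) && alternating w.

(* A_1 * A_2: the direct sum, over the alternating sequences epsilon, of the
   tensor products of the A_{epsilon_i}. *)
Definition free_prod : Type := word_space letter_comb alt_word.
HB.instance Definition _ := GRing.Lmodule.on free_prod.

Definition aword (w : seq L) : free_prod := word letter_comb alt_word w.

Definition mjoin (x y : L) (v : seq L) : seq L :=
  match x, y with
  | inl a, inl b => inl (nmul a b) :: v
  | inr a, inr b => inr (nmul a b) :: v
  | _, _ => [:: x, y & v]
  end.

(* Concatenation, with the two letters at the junction multiplied if they lie
   in the same algebra. *)
Fixpoint mcat (u v : seq L) : seq L :=
  match u, v with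
  | [::], _ => v
  | [:: x], [::] => [:: x]
  | [:: x], y :: v' => mjoin x y v'
  | x :: u', _ => x :: mcat u' v
  end.

Local Notation e := (fun x y : L => is_inl x != is_inl y).

Lemma path_side (x y : L) v : is_inl x = is_inl y -> path e x v = path e y v.
Proof. by case: v => //= z v ->. Qed.

Lemma mcat_path p x u v :
  path e p (x :: u) -> sorted e v -> path e p (mcat (x :: u) v).
Proof.
elim: u p x => [|y u ih] p x.
  case: v => [|y v] //=; rewrite andbT.
  case: x y => [a|a] [b|b] //= -> /=; rewrite ?andbT //.
  - by rewrite (@path_side (inl b) (inl (nmul a b))).
  - by rewrite (@path_side (inr b) (inr (nmul a b))).
move=> /andP[h1 h2] hv.
by rewrite -[mcat _ _]/(x :: mcat (y :: u) v) /= h1 ih.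
Qed.

Lemma mcat_alt u v : alt_word u -> alt_word v -> alt_word (mcat u v).
Proof.
case: u => [|x u] // /andP[_ hu] /andP[_ hv]; apply/andP; split.
  by case: u {hu} => [|y u] //=; case: v hv => // y v _; case: x y => a [].
pose p : L := if x is inl _ then inr 0 else inl 0.
have hp : path e p (x :: u) by move: hu; rewrite /alternating /= => ->; rewrite andbT /p; case: (x).
by have := mcat_path hp hv; case: (mcat _ _) => //= z s /andP[].
Qed.

Lemma mcat_cons2 x y u v : mcat [:: x, y & u] v = x :: mcat (y :: u) v.
Proof. by []. Qed.

Lemma mcat0 u : mcat u [::] = u.
Proof. by elim: u => [|x [|y u] ih] //; rewrite mcat_cons2 ih. Qed.

Lemma mcatA u v w : mcat u (mcat v w) = mcat (mcat u v) w.
Proof.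
elim: u => [|x [|x' u] ih] //; last first.
  rewrite !mcat_cons2 ih.
  have : mcat (x' :: u) v != [::].
    by case: u {ih} => [|y u] //=; case: v => // z v; case: x' z => a [].
  by case: (mcat _ _).
case: v {ih} => [|y [|y' v]] //.
  case: w => [|z w]; first by rewrite !mcat0.
  by case: x y z => [a|a] [b|b] [c|c] //=; rewrite nmulA.
rewrite mcat_cons2.
by case: x y => [a|a] [b|b] //=.
Qed.

Lemma aword_multilinear : multilinear letter_comb alt_word aword.
Proof. exact: word_multilinear. Qed.

Lemma mcat_cat s x y t v : mcat (s ++ [:: x, y & t]) v = s ++ x :: mcat (y :: t) v.
Proof. by elim: s => [|z [|z' s] ih] //; rewrite mcat_cons2 ih. Qed.

Lemma mcat_rcons s x v : mcat (s ++ [:: x]) v = s ++ mcat [:: x] v.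
Proof. by elim: s => [|z [|z' s] ih] //; rewrite mcat_cons2 ih. Qed.

Lemma mcat_catr x s l t :
  l != [::] -> mcat (x :: s) (l ++ t) = mcat (x :: s) l ++ t.
Proof.
elim: s x => [|y s ih] x hl; last by rewrite !mcat_cons2 ih.
by case: l hl => // z l _; case: x z => a [].
Qed.

Lemma mcat_multilinearl v : alt_word v ->
  multilinear letter_comb alt_word (fun u => aword (mcat u v)).
Proof.
move=> hv a s t l1 l2 l3 hl h1 h2 h3.
have := mcat_alt h3 hv; have := mcat_alt h2 hv; have := mcat_alt h1 hv.
case: t h1 h2 h3 => [|y t] _ _ _; last first.
  by rewrite !mcat_cat; apply: aword_multilinear.
rewrite !mcat_rcons; case: v {hv} => [|y v]; first exact: aword_multilinear.
case: hl => {}a x x'; case: y => y /=; try exact/aword_multilinear/LetterComb1;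
  try exact/aword_multilinear/LetterComb2.
- by rewrite (nmul_linl y a x x'); exact/aword_multilinear/LetterComb1.
- by rewrite (nmul_linl y a x x'); exact/aword_multilinear/LetterComb2.
Qed.

Lemma mcat_multilinearr u : alt_word u ->
  multilinear letter_comb alt_word (fun v => aword (mcat u v)).
Proof.
move=> hu a s t l1 l2 l3 hl h1 h2 h3.
have := mcat_alt hu h3; have := mcat_alt hu h2; have := mcat_alt hu h1.
have [r [y ->]] : exists r y, u = rcons r y.
  by case/lastP: u hu => // r y _; exists r, y.
rewrite -cats1 !mcat_rcons; case: s h1 h2 h3 => [|z s] _ _ _; last first.
  have hz l : mcat [:: y] ((z :: s) ++ l :: t) = mcat [:: y] (z :: s) ++ l :: t.
    exact: mcat_catr.
  by rewrite !hz !catA; apply: aword_multilinear.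
have hd (b c : L) : r ++ [:: b, c & t] = (r ++ [:: b]) ++ c :: t by rewrite -catA.
case: hl => {}a x x'; case: y => y /=; rewrite ?hd;
  try exact/aword_multilinear/LetterComb1; try exact/aword_multilinear/LetterComb2.
- by rewrite (nmul_linr y a x x'); exact/aword_multilinear/LetterComb1.
- by rewrite (nmul_linr y a x x'); exact/aword_multilinear/LetterComb2.
Qed.

Definition amul (x y : free_prod) : free_prod :=
  wlift2 (fun u v => aword (mcat u v)) x y.

Lemma amul_linl y : linear (amul^~ y).
Proof. exact: (wlift2_linl mcat_multilinearl mcat_multilinearr). Qed.

Lemma amul_linr x : linear (amul x).
Proof. exact: (wlift2_linr mcat_multilinearr). Qed.

Lemma amul_word u v :
  alt_word u -> alt_word v -> amul (aword u) (aword v) = aword (mcat u v).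
Proof. exact: (wlift2_word mcat_multilinearl mcat_multilinearr). Qed.

Lemma aword_ind (S : free_prod -> Prop) :
  S 0 -> (forall a x y, S x -> S y -> S (a *: x + y)) ->
  (forall w, alt_word w -> S (aword w)) -> forall x, S x.
Proof. exact: word_ind. Qed.

Lemma amulA : associative amul.
Proof.
move=> x y z; elim/aword_ind: x => [|a x x' hx hx'|u hu].
- by rewrite !(lin0 (amul_linl _)).
- by rewrite !(amul_linl _ a x x') hx hx' (amul_linl _ a).
elim/aword_ind: y => [|a x x' hx hx'|v hv].
- by rewrite (lin0 (amul_linl z)) !(lin0 (amul_linr _)) (lin0 (amul_linl z)).
- rewrite (amul_linl z a x x') !(amul_linr (aword u) a) hx hx'.
  by rewrite (amul_linl z a).
elim/aword_ind: z => [|a x x' hx hx'|w hw].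
- by rewrite !(lin0 (amul_linr _)).
- by rewrite !(amul_linr _ a x x') (amul_linr (aword u) a) hx hx'.
by rewrite !amul_word ?mcat_alt // mcatA.
Qed.

HB.instance Definition _ :=
  Lmodule_isNuAlg.Build k free_prod amulA amul_linl amul_linr.

Lemma nmul_aword u v : alt_word u -> alt_word v ->
  nmul (aword u) (aword v : free_prod) = aword (mcat u v).
Proof. exact: amul_word. Qed.

Definition letter (l : L) : free_prod := aword [:: l].

(* The embedding of the free product into its double tensor algebra, mapping
   the alternating word x_1 ... x_n to the word x_1 (x) ... (x) x_n. *)
Definition embed_fun (w : seq L) : tbar (tpos free_prod) :=
  bword [:: tword (map letter w)].

Lemma letter_comb_letter a x y z :
  letter_comb a x y z -> letter z = a *: letter x + letter y.
Proof. by move=> h; apply: (@aword_multilinear a [::] [::]). Qed.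

Lemma embed_multilinear : multilinear letter_comb alt_word embed_fun.
Proof.
move=> a s t x y z h _ _ _; rewrite /embed_fun !map_cat /=.
apply: (@bword_multilinear _ _ a [::] [::]) => //.
apply: word_multilinear; rewrite /lin_comb ?(letter_comb_letter h) //;
  by case: (map letter s).
Qed.

Definition embed : {linear free_prod -> tbar (tpos free_prod)} :=
  wlift embed_multilinear.

Lemma embed_word w : alt_word w -> embed (aword w) = bword [:: tword (map letter w)].
Proof. exact: wlift_word. Qed.

End FreeProduct.

Section CharacterOfForm.
Variables (k : fieldType) (A : nuAlgType k) (phi : {linear A -> k^o}).

Definition form_word (s : seq A) : k^o :=
  if s is x :: s' then phi (nprod x s') else 0.

Lemma nprod_linear (s : seq A) : linear (fun x => nprod x s).
Proof.
elim: s => [|y s ih] //= a x x'.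
by rewrite /nprod /= (nmul_linl y a x x') -/(nprod _ s) ih.
Qed.

Lemma form_word_multilinear :
  multilinear (@lin_comb k A) (@nonnil k A) form_word.
Proof.
move=> a [|u s] t x y z -> _ _ _ /=.
  by rewrite (nprod_linear t a x y) linearP.
rewrite /nprod !foldl_cat /= (nmul_linr _ a x y) -/(nprod _ t).
by rewrite (nprod_linear t a) linearP.
Qed.

Definition form_tpos : {linear tpos A -> k^o} := wlift form_word_multilinear.

(* The character w_1 | ... | w_m |-> phi (w_1) ... phi (w_m), where phi is
   extended to T(A) by phi (a_1 ... a_n) = phi (a_1 . ... . a_n). *)
Definition character_of : {lrmorphism tbar (tpos A) -> k^o} := blift form_tpos.

End CharacterOfForm.

Section Products.
Variables (k : fieldType) (A1 A2 : nuAlgType k).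
Variables (phi1 : {linear A1 -> k^o}) (phi2 : {linear A2 -> k^o}).
Local Notation A := (free_prod A1 A2).
Local Notation form := {linear A -> k^o}.

(* An alternating word without letters in A_2 (resp. A_1) has length one. *)
Definition extend1_fun (w : seq (A1 + A2)) : k^o :=
  if w is [:: inl x] then phi1 x else 0.
Definition extend2_fun (w : seq (A1 + A2)) : k^o :=
  if w is [:: inr x] then phi2 x else 0.

Lemma extend1_multilinear :
  multilinear (@letter_comb k A1 A2) (@alt_word k A1 A2) extend1_fun.
Proof.
have z a : 0 = a *: 0 + 0 :> k^o by rewrite scaler0 addr0.
move=> a s t x y w [{}a u v|{}a u v] _ _ _;
  case: s => [|[?|?] [|? ?]] //=; case: t => [|? ?] //=; exact: linearP.
Qed.

Lemma extend2_multilinear :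
  multilinear (@letter_comb k A1 A2) (@alt_word k A1 A2) extend2_fun.
Proof.
have z a : 0 = a *: 0 + 0 :> k^o by rewrite scaler0 addr0.
move=> a s t x y w [{}a u v|{}a u v] _ _ _;
  case: s => [|[?|?] [|? ?]] //=; case: t => [|? ?] //=; exact: linearP.
Qed.

Definition extend1 : form := wlift extend1_multilinear.
Definition extend2 : form := wlift extend2_multilinear.

Definition Phi1 : {lrmorphism tbar (tpos A) -> k^o} := character_of extend1.
Definition Phi2 : {lrmorphism tbar (tpos A) -> k^o} := character_of extend2.

Definition lefts (T1 T2 : Type) (w : seq (T1 + T2)) : seq T1 :=
  pmap (fun l => if l is inl x then Some x else None) w.
Definition rights (T1 T2 : Type) (w : seq (T1 + T2)) : seq T2 :=
  pmap (fun l => if l is inr x then Some x else None) w.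

Definition eval_prod (B : nuAlgType k) (phi : {linear B -> k^o}) (s : seq B) : k :=
  if s is x :: s' then phi (nprod x s') else 1.

Definition is_monotone_product (phi : form) : Prop :=
  forall w, alt_word w ->
  phi (aword w) = eval_prod phi1 (lefts w) * \prod_(y <- rights w) phi2 y.

Definition is_antimonotone_product (phi : form) : Prop :=
  forall w, alt_word w ->
  phi (aword w) = eval_prod phi2 (rights w) * \prod_(x <- lefts w) phi1 x.

Definition is_boolean_product (phi : form) : Prop :=
  forall w, alt_word w ->
  phi (aword w) = \prod_(x <- lefts w) phi1 x * \prod_(y <- rights w) phi2 y.

(* The unitization k1 (+) B is k * B, with unit (1, 0). *)
Definition unitization_mul (B : nuAlgType k) (x y : k * B) : k * B :=
  (x.1 * y.1, x.1 *: y.2 + y.1 *: x.2 + nmul x.2 y.2).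

Definition unital_ext (B : nuAlgType k) (phi : {linear B -> k^o}) (x : k * B) : k :=
  x.1 + phi x.2.

Definition unitization_incl (x : (k * A1) + (k * A2)) : k * A :=
  match x with
  | inl (c, a) => (c, letter (inl a : A1 + A2))
  | inr (c, a) => (c, letter (inr a : A1 + A2))
  end.

(* k1 (+) A_1 and k1 (+) A_2 are free in k1 (+) A with respect to the unital
   extension of phi. *)
Definition freely_independent (phi : form) : Prop :=
  forall b : seq ((k * A1) + (k * A2)), b != [::] -> alternating b ->
  (forall x, x \in b -> unital_ext phi (unitization_incl x) = 0) ->
  unital_ext phi
    (foldr (@unitization_mul A) (1, 0) (map unitization_incl b)) = 0.

Definition is_free_product (phi : form) : Prop :=
  [/\ forall x : A1, phi (letter (inl x)) = phi1 x,
      forall x : A2, phi (letter (inr x)) = phi2 x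
    & freely_independent phi].

Definition restrict (Phi : {lrmorphism tbar (tpos A) -> k^o}) : form :=
  Phi \o @embed k A1 A2.

End Products.

(* Main.v *)
Require Import Defs.
From mathcomp Require Import all_boot all_order all_algebra.
From mathcomp Require Import boolp ring.

Set Implicit Arguments.
Unset Strict Implicit.
Unset Printing Implicit Defensive.

Import GRing.Theory.
Local Open Scope ring_scope.

(* A character of H is determined by its values on single words, where the
   half-shuffle equations become moment-cumulant recursions. The infinitesimal
   forms of Phi_1 and Phi_2 vanish on words with a letter outside A_1, resp. A_2,
   since Phi_1 and Phi_2 do.
   For Phi_1 * Phi_2, only the subset of the positions of letters of A_1
   contributes, and its complement consists of isolated positions. For the
   boolean product, only the first letter of an alternating word can be split
   off, so Phi(x w) = phi_i(x) Phi(w).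
   For the free product, Phi(x_1 ... x_n) is the vacuum component of
   x_1 . x_2 . ... . x_n . 1, where letters act on the space of words by
   x . y_1 ... y_m = x y_1 ... y_m
     + sum_j kappa(x y_1 ... y_j) y_(j+1) ... y_m.
   As kappa vanishes on mixed words, a letter x of A_i only sees the leading run
   of letters of A_i. Hence the action inherits multiplicativity from phi_1 and
   phi_2, so Phi is computed on products taken in A; and applying an alternating
   sequence of centred letters only creates letters, so its vacuum component is
   0. *)

(** * Sums over subsets of a word *)

Section CutSums.
Variables (R : comNzRingType) (T : Type).
Implicit Types (F G f g : seq T -> R) (w u : seq T).

Definition isnil w : R := (nilp w)%:R.

(* The sum, over the subsets S of the positions of w, of f(w_S) G(J_0)
   F(J_1) ... F(J_l), where J_0, ..., J_l are the l + 1 (possibly empty) words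
   between the l letters of w_S. For F = G with F [::] = 1 this is f * F on w. *)
Fixpoint cutsum F G f w : R :=
  if w is z :: w' then
    G [::] * cutsum F F (fun u => f (z :: u)) w' + cutsum F (fun u => G (z :: u)) f w'
  else f [::] * G [::].

(** The convolution of [G] and [f] for deconcatenation: [G] reads a prefix of [w] and [f] the
    remaining suffix. *)
Fixpoint splitsum G f w : R :=
  if w is z :: w' then
    G [::] * f (z :: w') + splitsum (fun u => G (z :: u)) f w'
  else G [::] * f [::].

(** The size bounds serve recursions on the length of words; [a] serves words over part of the
    alphabet. *)
Lemma eq_cutsum (a : pred T) F F' G G' f f' w : all a w ->
  (forall u, all a u -> size u <= size w -> F u = F' u)%N ->
  (forall u, all a u -> size u <= size w -> G u = G' u)%N ->
  (forall u, all a u -> size u <= size w -> f u = f' u)%N ->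
  cutsum F G f w = cutsum F' G' f' w.
Proof.
elim: w F F' G G' f f' => [|z w ih] F F' G G' f f' /=.
  by move=> _ hF hG hf; rewrite hG // hf.
case/andP=> hz hw hF hG hf; rewrite hG //; congr (_ * _ + _); apply: ih => // u hu hs.
all: by rewrite ?hF ?hG ?hf //= ?hz ?hu // ltnW.
Qed.

Lemma eq_cutsum_fun F F' G G' f f' : F =1 F' -> G =1 G' -> f =1 f' ->
  cutsum F G f =1 cutsum F' G' f'.
Proof. by move=> hF hG hf w; apply: (@eq_cutsum predT); rewrite ?all_predT. Qed.

Lemma cutsum_lin F G f g c w :
  cutsum F G (fun u => c * f u + g u) w = c * cutsum F G f w + cutsum F G g w.
Proof. by elim: w G f g => [|z w ih] G f g /=; rewrite ?ih; ring. Qed.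

Lemma cutsum_lin_first F G G' f c w :
  cutsum F (fun u => c * G u + G' u) f w = c * cutsum F G f w + cutsum F G' f w.
Proof. by elim: w G G' f => [|z w ih] G G' f /=; rewrite ?ih; ring. Qed.

Lemma cutsum0 F G w : cutsum F G (fun=> 0) w = 0.
Proof. by elim: w G => [|z w ih] G /=; rewrite ?ih ?mul0r // mulr0 addr0. Qed.

Lemma cutsum0_first F f w : cutsum F (fun=> 0) f w = 0.
Proof. by elim: w f => [|z w ih] f /=; rewrite ?ih ?mulr0 // mul0r addr0. Qed.

(** Only the full subset survives, since any other one hands [f] a shorter word. Its first gap gives
    [G [::]], its other gaps [F [::] = 1]. *)
Lemma cutsum_top (a : pred T) F G f w : F [::] = 1 -> all a w ->
  (forall u, all a u -> (size u < size w)%N -> f u = 0) ->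
  cutsum F G f w = f w * G [::].
Proof.
move=> F1; elim: w G f => [//|z w ih] G f /= /andP[hz hw] hf.
rewrite ih //; last by move=> u hu hs; apply: hf => //=; rewrite hz.
rewrite F1 mulr1 mulrC (@eq_cutsum a F F _ (fun u => G (z :: u)) f (fun=> 0)) //.
by rewrite cutsum0 addr0.
Qed.

Lemma cutsum_top_first F G f w :
  (forall u, (size u < size w)%N -> G u = 0) -> cutsum F G f w = G w * f [::].
Proof.
elim: w G => [|z w ih] G /= hG; first exact: mulrC.
by rewrite hG // mul0r add0r ih // => u hu; apply: hG.
Qed.

Lemma cutsum_isnil F G w : cutsum F G isnil w = G w.
Proof.
by elim: w G => [|z w ih] G /=; rewrite ?mul1r // cutsum0 mulr0 add0r ih.
Qed.

Lemma cutsum_isnil_all f w : cutsum isnil isnil f w = f w.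
Proof.
elim: w f => [|z w ih] f /=; first by rewrite mulr1.
by rewrite cutsum0_first addr0 mul1r ih.
Qed.

(** When every gap but the first must be empty, the subset is a suffix of [w] and the first gap is
    the complementary prefix. *)
Lemma cutsum_isnil_rest G f w : cutsum isnil G f w = splitsum G f w.
Proof.
elim: w G => [|z w ih] G /=; first exact: mulrC.
by rewrite cutsum_isnil_all ih.
Qed.

Lemma cutsum_isnil_first F f x w :
  cutsum F isnil f (x :: w) = cutsum F F (fun u => f (x :: u)) w.
Proof. by rewrite /= mul1r cutsum0_first addr0. Qed.

(* The coassociativity of the coproduct, tested on three functions. *)
Lemma cutsum_cutsum F G g f w :
  cutsum F (cutsum F G g) f w = cutsum F G (splitsum g f) w.
Proof.
elim: w G g => [|z w ih] G g; first by rewrite /=; ring.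
rewrite [LHS]/= [RHS]/= cutsum_lin_first cutsum_lin !ih.
by ring.
Qed.

Lemma splitsum_eq0 G f w : (forall u, G u = 0) -> splitsum G f w = 0.
Proof. by elim: w G => [|z w ih] G h /=; rewrite h mul0r // add0r ih. Qed.

(** The step at [w] looks only at shorter words, so the iterates at [w] are constant from index
    [size w + 1] on. *)
Lemma seq_rec (step : (seq T -> R) -> seq T -> R) :
  (forall f g w, (forall u, size u < size w -> f u = g u)%N ->
    step f w = step g w) ->
  exists f, forall w, f w = step f w.
Proof.
move=> hstep; pose it n := iter n step (fun=> 0).
have h n m w : (size w < n)%N -> (size w < m)%N -> it n w = it m w.
  elim: n m w => [|n ih] [|m] w //= hn hm.
  by apply: hstep => u hu; apply: ih; apply: leq_trans hu _.
exists (fun w => it (size w).+1 w) => w.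
by apply: hstep => u hu; apply: h.
Qed.

End CutSums.

(** * Multilinearity of sums over subsets *)

Section CutSumsMultilinear.
Variables (k : fieldType) (V : lmodType k).
Implicit Types (F G f : seq V -> k).

(** The words concerned have length at most [n]; this bound makes multilinearity accessible to
    induction on the length. *)
Definition mlin n f := forall a s t (x y : V), (size s + size t < n)%N ->
  f (s ++ (a *: x + y) :: t) = a * f (s ++ x :: t) + f (s ++ y :: t).

Lemma mlinW m n f : (m <= n)%N -> mlin n f -> mlin m f.
Proof. by move=> h hf a s t x y hs; apply: hf; apply: leq_trans h. Qed.

Lemma mlin_cons n f z : mlin n.+1 f -> mlin n (fun u => f (z :: u)).
Proof. by move=> hf a s t x y hs; apply: (hf a (z :: s)). Qed.

Lemma mlin_isnil n : mlin n (@isnil k V).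
Proof. by move=> a [|z s] t x y _; rewrite /isnil /= mulr0 addr0. Qed.

(** Induction on the prefix brings the varied letter to the front, where it belongs to the subset or
    to the current first gap; the sum is linear in [f] and in [G]. *)
Lemma cutsum_mlin n F G f : mlin n F -> mlin n G -> mlin n f ->
  mlin n (cutsum F G f).
Proof.
move=> hF hG hf a s; elim: s n F G f hF hG hf => [|z s ih] n F G f hF hG hf t x y /=.
  case: n hF hG hf => [//|n] hF hG hf hs.
  rewrite (@eq_cutsum k V predT F F F F _
     (fun u => a * f (x :: u) + f (y :: u))) ?all_predT //; last first.
    by move=> u _ hu; apply: (hf a [::]); apply: leq_ltn_trans hs.
  rewrite (@eq_cutsum k V predT F F _
     (fun u => a * G (x :: u) + G (y :: u)) f f) ?all_predT //; last first.
    by move=> u _ hu; apply: (hG a [::]); apply: leq_ltn_trans hs.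
  by rewrite cutsum_lin cutsum_lin_first; ring.
case: n hF hG hf => [//|n] hF hG hf hs.
have hw g : mlin n.+1 g -> mlin n g by apply: mlinW.
rewrite !(ih n); first by ring.
all: by [exact: hw|exact: mlin_cons|].
Qed.

Definition trunc n f u : k := if (size u < n)%N then f u else 0.

(** The three words of a linearity relation have the same length, so truncation keeps or kills them
    together. *)
Lemma mlin_trunc n f : mlin n.-1 f -> forall m, mlin m (trunc n f).
Proof.
move=> hf m a s t x y _; rewrite /trunc !size_cat /= addnS.
by case: ltnP => h; [apply: hf; rewrite -ltnS (ltn_predK h)|rewrite mulr0 addr0].
Qed.

Lemma multilinear_of_mlin f : (forall n, mlin n f) ->
  multilinear (@lin_comb k V) (@nonnil k V) (f : seq V -> k^o).
Proof. by move=> h a s t x y z -> _ _ _; apply: (h (size s + size t).+1). Qed.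

End CutSumsMultilinear.

(** * Words with vanishing mixed free cumulants *)

Section VanishingMixedCumulants.
Variables (R : comNzRingType) (T : eqType) (col : T -> bool) (mul : T -> T -> T).
Variables (F kappa : seq T -> R).
Hypothesis col_mul : forall a b, col a = col b -> col (mul a b) = col a.
Hypothesis F_nil : F [::] = 1.
Hypothesis F_cons : forall x w,
  F (x :: w) = cutsum F F (fun u => kappa (x :: u)) w.
Hypothesis kappa_mixed : forall u x y v,
  col x != col y -> kappa (u ++ [:: x, y & v]) = 0.

Local Notation mono i := (fun x : T => col x == i).

Hypothesis F_mono : forall (i : bool) p a b q, all (mono i) (p ++ [:: a, b & q]) ->
  F (p ++ [:: a, b & q]) = F (p ++ mul a b :: q).

Implicit Types (f g psi : seq T -> R) (u v w : seq T).

(* Left multiplication by the letter x on the Fock space spanned by the words,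
   in dual form: x . y_1 ... y_n is x y_1 ... y_n plus the sum over j of
   kappa (x y_1 ... y_j) y_(j+1) ... y_n. *)
Definition op x f u : R := f (x :: u) + splitsum (fun v => kappa (x :: v)) f u.

(** Either [x] is in the subset, or it opens the first gap, whose moment expands into cumulants;
    [cutsum_cutsum] reassembles the second case. By iteration, [cutsum F F f] pairs [f] with the
    vector that a word produces from the vacuum. *)
Lemma cutsum_op f x w : cutsum F F f (x :: w) = cutsum F F (op x f) w.
Proof.
have hF : (fun u => F (x :: u)) =1 cutsum F F (fun u => kappa (x :: u)).
  by move=> u; rewrite F_cons.
rewrite /= (eq_cutsum_fun (frefl F) hF (frefl f)) cutsum_cutsum.
rewrite F_nil -cutsum_lin; apply: eq_cutsum_fun => // u.
by rewrite /op mul1r.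
Qed.

Lemma eq_splitsum (a : pred T) G f g u : all a u ->
  (forall v, all a v -> f v = g v) -> splitsum G f u = splitsum G g u.
Proof.
move=> hu h; elim: u G hu => [|z u ih] G /= hu; first by rewrite h.
by rewrite h // ih //; case/andP: hu.
Qed.

Lemma eq_op (a : pred T) x f g u : a x -> all a u ->
  (forall v, all a v -> f v = g v) -> op x f u = op x g u.
Proof.
by move=> hx hu h; rewrite /op h /= ?hx //; congr (_ + _); apply: eq_splitsum hu h.
Qed.

Lemma splitsum_cat (G : seq T -> R) f r t :
  (if t is y :: _ then forall v, G (r ++ y :: v) = 0 else True) ->
  splitsum G f (r ++ t) = splitsum G (fun u => f (u ++ t)) r.
Proof.
elim: r G => [|z r ih] G h; last by rewrite /= ih //; case: t h.
by case: t h => [//|y t] h; rewrite /= splitsum_eq0 ?addr0.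
Qed.

Definition starts (i : bool) w := if w is y :: _ then col y == i else false.
Definition ends (i : bool) w := if w is y :: w' then col (last y w') == i else false.

Lemma op_cat i x f r t : all (mono i) (x :: r) -> ~~ starts i t ->
  op x f (r ++ t) = op x (fun u => f (u ++ t)) r.
Proof.
move=> hr ht; rewrite /op splitsum_cat //; case: t ht => [//|y t] /= ht v.
(* The last letter of [x :: r] has colour [i] and the next letter [y] has not. *)
rewrite -cat_cons lastI cat_rcons kappa_mixed //.
have /allP /(_ _ (mem_last x r)) /eqP -> := hr.
by rewrite eq_sym.
Qed.

(* In the Fock space of a single algebra the vectors produced by a word of
   letters depend only on the product of the letters once the kernel of the
   vacuum state is divided out; f is a functional that factors through this
   quotient. *)
Definition mult_on i f := forall p a b q, all (mono i) (p ++ [:: a, b & q]) ->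
  cutsum F F f (p ++ [:: a, b & q]) = cutsum F F f (p ++ mul a b :: q).

Lemma all_mul i p a b q : all (mono i) (p ++ [:: a, b & q]) ->
  all (mono i) (p ++ mul a b :: q).
Proof.
rewrite !all_cat /= => /and4P[-> /eqP ha /eqP hb ->].
by rewrite col_mul ?ha ?hb ?eqxx.
Qed.

Lemma mult_on_lin i c f g : mult_on i f -> mult_on i g ->
  mult_on i (fun u => c * f u + g u).
Proof. by move=> hf hg p a b q h; rewrite !cutsum_lin hf ?hg. Qed.

Lemma mult_on_isnil i c : mult_on i (fun u => c * isnil R u).
Proof.
move=> p a b q h.
have e : (fun u => c * isnil R u) =1 (fun u => c * isnil R u + 0).
  by move=> u; rewrite addr0.
rewrite !(eq_cutsum_fun (frefl F) (frefl F) e) !cutsum_lin !cutsum_isnil.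
by rewrite !cutsum0 (F_mono h).
Qed.

(* The value at the empty word is irrelevant, because the functional isnil is
   itself multiplicative: its moments are those of F. *)
Lemma mult_on_eq i f g : mult_on i f ->
  (forall u, all (mono i) u -> u != [::] -> g u = f u) -> mult_on i g.
Proof.
move=> hf h.
have e w : all (mono i) w ->
    cutsum F F g w = cutsum F F (fun u => (g [::] - f [::]) * isnil R u + f u) w.
  move=> hw; apply: eq_cutsum hw _ _ _ => // [[|y u]] hu _.
    by rewrite /isnil mulr1 subrK.
  by rewrite h // /isnil mulr0 add0r.
move=> p a b q hw; rewrite e // e ?all_mul // !cutsum_lin hf //.
by rewrite !cutsum_isnil (F_mono hw).
Qed.

Lemma mult_on_op i x f : col x = i -> mult_on i f -> mult_on i (op x f).
Proof.
move=> hx hf p a b q h; rewrite -!cutsum_op -!cat_cons hf //=.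
by rewrite hx eqxx.
Qed.

(* The condition on maximal runs of one colour is preserved by every op x, which
   reduces multiplicativity of F at any place of a word to its first two
   letters. *)
Definition mult_form psi := forall i c t, ~~ ends i c -> ~~ starts i t ->
  mult_on i (fun r => psi (c ++ r ++ t)).

(** Each term cuts a prefix off [c]; what remains of [c] still does not end in colour [i], so
    [mult_form psi] applies to it. *)
Lemma mult_on_splitsum psi i t (G : seq T -> R) c :
  mult_form psi -> ~~ ends i c -> ~~ starts i t ->
  mult_on i (fun r => splitsum G (fun u => psi (u ++ r ++ t)) c).
Proof.
move=> hpsi hc ht; elim: c G hc => [|z c ih] G hc /=.
  have := mult_on_lin (G [::]) (hpsi i [::] t isT ht) (mult_on_isnil (i := i) 0).
  by move/mult_on_eq; apply=> u _ _; rewrite mul0r addr0.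
apply: mult_on_lin; first exact: (hpsi i (z :: c)).
by apply: ih; case: c hc.
Qed.

(** Either [c] is empty and [x] has colour [i], so that [x] extends the run, or no nonzero cumulant
    starting at [x] reaches into the run and all splits happen along [c]. *)
Lemma mult_form_op x psi : mult_form psi -> mult_form (op x psi).
Proof.
move=> hpsi i c t hc ht; case: (boolP (ends i (x :: c))) => hxc.
  case: c hc hxc => [_ /= hx|y c /= /negP//].
  apply: mult_on_eq (mult_on_op (eqP hx) (hpsi i [::] t isT ht)) _ => u hu _.
  by rewrite /= (@op_cat i) //= hx.
have h1 := hpsi i (x :: c) t hxc ht.
have h2 := mult_on_splitsum (fun v => kappa (x :: v)) hpsi hc ht.
apply: mult_on_eq (mult_on_lin 1 h1 h2) _ => -[//|z u] /= /andP[/eqP hz _] _.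
rewrite /op mul1r; congr (_ + _); rewrite splitsum_cat // => v.
by rewrite -cat_cons lastI cat_rcons kappa_mixed // hz.
Qed.

Lemma mult_form_isnil : mult_form (@isnil R T).
Proof.
move=> i [|y c] t _ _; last first.
  by apply: mult_on_eq (mult_on_isnil (i := i) 0) _ => u _ _; rewrite mul0r.
case: t => [|y t].
  by apply: mult_on_eq (mult_on_isnil (i := i) 1) _ => u _ _; rewrite mul1r cats0.
by apply: mult_on_eq (mult_on_isnil (i := i) 0) _ => -[|z u] _ _; rewrite mul0r.
Qed.

(** By [cutsum_top] and [F [::] = 1], the passage from [f] to its sums is unitriangular for the
    length of words. *)
Lemma cutsum_inj (a : pred T) f g :
  (forall w, all a w -> cutsum F F f w = cutsum F F g w) ->
  forall w, all a w -> f w = g w.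
Proof.
move=> h w; have [n hn] := ubnP (size w); elim: n w hn => [//|n ih] w hn hw.
apply/eqP; rewrite -subr_eq0; apply/eqP.
have := @cutsum_top R T a F F (fun u => -1 * g u + f u) w F_nil hw.
rewrite cutsum_lin h // F_nil mulr1 !mulN1r addNr addrC => <- //.
move=> u hu hs; rewrite ih // ?mulN1r ?addNr //.
by apply: leq_trans hs _.
Qed.

(** The letters act only on the leading run [r] of [t]. On words of one colour [cutsum_inj] reduces
    the claim to sums, where [cutsum_op] puts [a] and [b] back in front of the word and [mult_on]
    merges them. *)
Lemma op_mul a b psi t : col a = col b -> mult_form psi ->
  op b (op a psi) t = op (mul a b) psi t.
Proof.
move=> hab hpsi; pose i := col a.
have [r [t' [-> hr ht]]] : exists r t',
    [/\ t = r ++ t', all (mono i) r & ~~ starts i t'].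
  elim: t => [|y t [r [t' [-> hr ht]]]]; first by exists [::], [::].
  case: (boolP (col y == i)) => hy; last by exists [::], (y :: r ++ t').
  by exists (y :: r), t'; split; rewrite //= hy.
have ha : col a == i by rewrite /i.
have hb : col b == i by rewrite -hab.
have hm : col (mul a b) == i by rewrite col_mul.
pose f u := psi (u ++ t').
have hf : mult_on i f by apply: (hpsi i [::] t').
have hbr : all (mono i) (b :: r) by rewrite /= hb.
have hmr : all (mono i) (mul a b :: r) by rewrite /= hm.
rewrite (op_cat _ hbr ht) (op_cat _ hmr ht).
rewrite (@eq_op (mono i) _ _ (op a f)) //; last first.
  by move=> v hv; rewrite (@op_cat i) //= ha.
apply: (@cutsum_inj (mono i)) hr => w hw.
rewrite -!cutsum_op; apply: (hf [::]).
by rewrite /= ha hb.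
Qed.

(** [F] is the sum with functional [isnil]. The letters of [u] are absorbed into the functional,
    which stays in [mult_form], until [a] and [b] come first. *)
Lemma F_mul u a b v : col a = col b -> F (u ++ [:: a, b & v]) = F (u ++ mul a b :: v).
Proof.
move=> hab; rewrite -[LHS](cutsum_isnil F) -[RHS](cutsum_isnil F).
elim: u (@isnil R T) mult_form_isnil => [|x u ih] psi hpsi.
  rewrite !cutsum_op; apply: eq_cutsum_fun => // t.
  exact: op_mul.
by rewrite !cat_cons 2!cutsum_op; apply: ih; apply: mult_form_op.
Qed.

(* The expansion of (c_1 + x_1) ... (c_n + x_n) as a combination of words. *)
Fixpoint expand (b : seq (R * T)) : seq (R * seq T) :=
  if b is x :: b' then
    [seq (x.1 * p.1, p.2) | p <- expand b'] ++ [seq (p.1, x.2 :: p.2) | p <- expand b']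
  else [:: (1, [::])].

(** This isolates the term of full length, for an induction on the length that solves for its
    value. *)
Lemma expand_top (b : seq (R * T)) : exists2 E,
  expand b = rcons E (1, [seq x.2 | x <- b])
  & all (fun p => size p.2 < size b)%N E.
Proof.
elim: b => [|x b [E e hE]] /=; first by exists [::].
rewrite e !map_rcons /= -rcons_cat; eexists; first by [].
rewrite all_cat all_rcons !all_map /= size_map ltnSn /=.
apply/andP; split; apply: sub_all hE => p //= hp.
exact: ltnW.
Qed.

(* A centred letter followed by a letter of the other colour acts on the Fock
   space as a pure creation operator. *)
Lemma expand_centered f b : sorted (fun x y => col x.2 != col y.2) b ->
  {in b, forall x, x.1 + kappa [:: x.2] = 0} ->
  \sum_(p <- expand b) p.1 * cutsum F F f p.2 = f [seq x.2 | x <- b].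
Proof.
elim: b f => [|[c x] b ih] f /= hs hc.
  by rewrite big_seq1 /= F_nil mulr1 mul1r.
rewrite big_cat /= !big_map -big_split.
rewrite (eq_bigr (fun p => p.1 * cutsum F F (fun u => c * f u + op x f u) p.2));
  last by move=> p _; rewrite cutsum_lin -cutsum_op /=; ring.
rewrite ih; last 2 first.
- exact: path_sorted hs.
- by move=> y hy; apply: hc; rewrite inE hy orbT.
have := hc _ (mem_head _ _); rewrite /= => hcx; rewrite /op.
have -> : splitsum (fun v => kappa (x :: v)) f [seq y.2 | y <- b]
    = kappa [:: x] * f [seq y.2 | y <- b].
  case: b hs {ih hc} => [//|y b] /= /andP[hxy _].
  by rewrite splitsum_eq0 ?addr0 // => u; apply: (kappa_mixed [::]).
by rewrite addrCA -mulrDl hcx mul0r addr0.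
Qed.

End VanishingMixedCumulants.

(** * Characters and infinitesimal forms on words *)

Lemma sum_tuple_cons (R : nmodType) (S : finType) n (f : seq S -> R) :
  \sum_(m : n.+1.-tuple S) f m = \sum_(b : S) \sum_(m : n.-tuple S) f (b :: m).
Proof.
rewrite pair_bigA /=.
rewrite (reindex (fun p : S * n.-tuple S => [tuple of p.1 :: p.2])) //=.
exists (fun m : n.+1.-tuple S => (thead m, [tuple of behead m])) => [[b m]|m] _.
  by congr (_, _); apply/val_inj.
by rewrite [RHS]tuple_eta.
Qed.

Lemma sum_bool_tuple_cons (R : nmodType) n (f : seq bool -> R) :
  \sum_(m : n.+1.-tuple bool) f m =
  \sum_(m : n.-tuple bool) f (true :: m) + \sum_(m : n.-tuple bool) f (false :: m).
Proof. by rewrite sum_tuple_cons big_bool. Qed.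

Lemma pieces_eta T m (s : seq T) :
  pieces m s = head [::] (pieces m s) :: behead (pieces m s).
Proof. by case: m s => [|[] m] [|x s]. Qed.

(** With empty pieces kept, a letter outside the subset joins the head piece and a letter inside it
    puts an empty piece in front, which is the recursion of [cutsum]. *)
Lemma sum_pieces (R : comNzRingType) T (F G f : seq T -> R) s :
  \sum_(m : (size s).-tuple bool)
    f (mask m s) * (G (head [::] (pieces m s))
      * \prod_(w <- behead (pieces m s)) F w) = cutsum F G f s.
Proof.
elim: s G f => [|x s ih] G f /=.
  rewrite (big_pred1 [tuple]) => [|m]; first by rewrite /= big_nil mulr1.
  by rewrite (tuple0 m).
rewrite (@sum_bool_tuple_cons R _ (fun m => f (mask m (x :: s)) *
  (G (head [::] (pieces m (x :: s))) * \prod_(w <- behead (pieces m (x :: s))) F w))).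
congr (_ + _) => /=; last exact: ih.
rewrite -ih mulr_sumr; apply: eq_bigr => m _.
by rewrite [in LHS]pieces_eta big_cons mulrCA.
Qed.

Section Words.
Variables (k : fieldType) (V : lmodType k).
Local Notation H := (tbar (tpos V)).
Local Notation form := {linear H -> k^o}.
Local Notation character := {lrmorphism H -> k^o}.
Implicit Types (f g : form) (s : seq V).

(** A property of linear forms, so that it also applies to forms without a bundled morphism
    structure, such as convolutions. *)
Definition is_char g : Prop :=
  g 1 = 1 /\ forall x y, g (x * y) = (g x : k) * (g y : k).

Definition char_form (Phi : character) : form := Phi.

Lemma char_formP (Phi : character) : is_char (char_form Phi).
Proof. by split=> [|x y]; [exact: (rmorph1 Phi)|exact: (rmorphM Phi)]. Qed.

(** [nonempty] sends the empty word to the unit of the bar algebra, whereas [tword [::]] is 0. *)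
Definition on_words f s : k := f (dword (nonempty [:: s])).

Lemma on_words_nil f : on_words f [::] = f 1. Proof. by []. Qed.

Lemma on_words_char_nil g : is_char g -> on_words g [::] = 1.
Proof. by case. Qed.

Lemma on_words_counit : on_words (char_form (counit V)) =1 @isnil k V.
Proof.
case=> [|x s]; first by rewrite on_words_char_nil //; exact: char_formP.
by rewrite /on_words /char_form /= /dword /counit bliftE big_seq1.
Qed.

Lemma char_dword g ws : is_char g ->
  g (dword (nonempty ws)) = \prod_(w <- ws) on_words g w :> k.
Proof.
move=> hg; elim: ws => [|w ws ih]; first by rewrite big_nil; exact: hg.1.
rewrite big_cons -ih; case: w => [|x w].
  by rewrite on_words_char_nil // mul1r.
by rewrite -[RHS]hg.2 /dword bwordM.
Qed.

Lemma eq_char f g : is_char f -> is_char g ->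
  (forall s, s != [::] -> on_words f s = on_words g s) -> f =1 g.
Proof.
move=> hf hg h; elim/bword_ind => [|a x y hx hy|ts]; first by rewrite !raddf0.
  by rewrite !linearP /= hx hy.
elim: ts => [|t ts ih]; first by rewrite bword0 hf.1 hg.1.
rewrite -cat1s -bwordM hf.2 hg.2 ih; congr (_ * _).
have hl f' : linear (fun t => (f' : form) (bword [:: t])).
  move=> a x y; rewrite -linearP; congr (f' _).
  exact: (@bword_multilinear k (tpos V) a [::] [::]).
elim/word_ind: t => [|a x y hx hy|[//|z s] _].
- by rewrite (lin0 (hl f)) (lin0 (hl g)).
- by rewrite (hl f a x y) (hl g a x y) /= hx hy.
- exact: (h (z :: s)).
Qed.

End Words.

(** * Convolution and half-products evaluated on words *)

Section HalfProducts.
Variables (k : fieldType) (V : lmodType k).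
Local Notation H := (tbar (tpos V)).
Local Notation form := {linear H -> k^o}.
Local Notation character := {lrmorphism H -> k^o}.
Local Notation e := (char_form (counit V)).
Implicit Types (f g alpha : form) (s : seq V) (x y a b : H).

Lemma counit_char : is_char e. Proof. exact: char_formP. Qed.

Lemma counit1 : e 1 = 1. Proof. by case: counit_char. Qed.

Lemma counit_bword t ts : e (bword (t :: ts)) = 0.
Proof. by rewrite /char_form /= /counit bliftE big_cons mul0r. Qed.

Lemma redE x : red x = x - (e x : k) *: 1. Proof. by []. Qed.

Lemma reduced_eq f x : f 1 = 0 -> reduced f x = f x.
Proof. by move=> h; rewrite /reduced /= redE linearB linearZ /= h scaler0 subr0. Qed.

Lemma reduced_char g x : is_char g -> reduced g x = g x - e x :> k.
Proof.
move=> hg; rewrite /reduced /= redE linearB linearZ /= hg.1.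
by rewrite -[_ *: 1]/(_ * 1) mulr1.
Qed.

(** On bar words, either a factor is [1] or both factors lie in the kernel of the counit; so [alpha]
    is a derivation over the counit. *)
Lemma infinitesimal_mul alpha x y : infinitesimal alpha ->
  alpha (x * y) = (alpha x : k) * (e y : k) + (e x : k) * (alpha y : k).
Proof.
case=> h1 h2.
elim/bword_ind: x => [|c x x' hx hx'|s].
- by rewrite mul0r !raddf0 !mul0r addr0.
- rewrite mulrDl -scalerAl !linearP /= hx hx' -![_ *: _]/(_ * _).
  by ring.
elim/bword_ind: y => [|c y y' hy hy'|t].
- by rewrite mulr0 !raddf0 !mulr0 addr0.
- rewrite mulrDr -scalerAr !linearP /= hy hy' -![_ *: _]/(_ * _).
  by ring.
case: s => [|z s]; first by rewrite bword0 mul1r h1 counit1 mul0r mul1r add0r.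
case: t => [|z' t]; first by rewrite bword0 mulr1 h1 counit1 mulr0 mulr1 addr0.
have [u1 u2] := (counit_bword z s, counit_bword z' t).
by rewrite (h2 _ _ u1 u2) u1 u2 mul0r mulr0 addr0.
Qed.

Lemma infinitesimal_dword alpha s ws : infinitesimal alpha -> s != [::] ->
  alpha (dword (nonempty (s :: ws)))
    = on_words alpha s * \prod_(w <- ws) isnil k w.
Proof.
move=> h; case: s => // x s _.
have -> : dword (nonempty ((x :: s) :: ws))
    = dword [:: x :: s] * dword (nonempty ws) :> H by rewrite bwordM.
rewrite infinitesimal_mul // counit_bword mul0r addr0.
rewrite (char_dword ws counit_char); congr (_ * _).
by apply: eq_bigr => w _; rewrite (on_words_counit w).
Qed.

Lemma tform_cut f g m s : is_char g ->
  tform f g (cut m s)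
    = on_words f (mask m s) * \prod_(w <- pieces m s) on_words g w.
Proof. by move=> hg; rewrite tform_pure -char_dword. Qed.

Lemma tform_delta f g s : is_char g -> s != [::] ->
  tform f g (delta V predT (tword s))
    = cutsum (on_words g) (on_words g) (on_words f) s.
Proof.
move=> hg hs; rewrite delta_word // raddf_sum -sum_pieces.
apply: eq_bigr => m _; apply: etrans (tform_cut f m s hg) _.
by rewrite [in LHS]pieces_eta big_cons.
Qed.

(** A subset containing the first position has an empty first gap, which [isnil] records. *)
Lemma tform_delta_prec f g s : is_char g -> s != [::] ->
  tform f g (delta V (head false) (tword s))
    = cutsum (on_words g) (@isnil k V) (on_words f) s.
Proof.
move=> hg; case: s => // x s hs; rewrite delta_word // raddf_sum big_mkcond /=.
rewrite (@sum_bool_tuple_cons _ _ (fun m => if head false m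
  then tform f g (cut m (x :: s)) else 0)) /= [X in _ + X]big1 // addr0.
rewrite cutsum0_first addr0 mul1r -sum_pieces.
apply: eq_bigr => m _; apply: etrans (tform_cut f (true :: m) (x :: s) hg) _.
rewrite /= big_cons on_words_char_nil // mul1r.
by rewrite [in LHS]pieces_eta big_cons.
Qed.

(** The first gap contains the first letter, so [alpha] kills every term with another nonempty
    gap. *)
Lemma tform_delta_succ g alpha s : infinitesimal alpha -> s != [::] ->
  tform g alpha (delta V (fun m => ~~ head false m) (tword s))
    = cutsum (@isnil k V) (on_words alpha) (on_words g) s.
Proof.
move=> h; case: s => // x s hs; rewrite delta_word // raddf_sum big_mkcond /=.
rewrite (@sum_bool_tuple_cons _ _ (fun m => if ~~ head false m
  then tform g alpha (cut m (x :: s)) else 0)) /= [X in X + _]big1 // add0r.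
rewrite on_words_nil h.1 mul0r add0r -sum_pieces.
apply: eq_bigr => m _; apply: etrans (tform_pure g alpha _ _) _; congr (_ * _).
exact: (@infinitesimal_dword alpha (x :: head [::] (pieces m s))).
Qed.

(** With [a] in the kernel of the counit, the derivation rule leaves the left part of [Y] to the
    counit. *)
Lemma tform_mul_inf alpha g a b (Y : tens H H) :
  infinitesimal alpha -> is_char g -> e a = 0 ->
  tform alpha g ((tpure a b : tens H H) * Y)
    = (alpha a : k) * (g b : k) * tform e g Y :> k.
Proof.
move=> h hg ha; elim/tens_ind: Y => [|c X Y hX hY|u v].
- by rewrite mulr0 !raddf0 mulr0.
- rewrite mulrDr -scalerAr !linearP /= hX hY.
  by rewrite -![_ *: _]/(_ * _); ring.
- rewrite dtens_mul !tform_pure (infinitesimal_mul a u h) ha mul0r addr0 hg.2.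
  by ring.
Qed.

Lemma tform_inf_mul g alpha a b (Y : tens H H) :
  infinitesimal alpha -> is_char g -> e b = 0 ->
  tform g alpha ((tpure a b : tens H H) * Y)
    = (g a : k) * (alpha b : k) * tform g e Y :> k.
Proof.
move=> h hg hb; elim/tens_ind: Y => [|c X Y hX hY|u v].
- by rewrite mulr0 !raddf0 mulr0.
- rewrite mulrDr -scalerAr !linearP /= hX hY.
  by rewrite -![_ *: _]/(_ * _); ring.
- rewrite dtens_mul !tform_pure (infinitesimal_mul b v h) hb mul0r addr0 hg.2.
  by ring.
Qed.

Lemma tform_charM f g (X Y : tens H H) : is_char f -> is_char g ->
  tform f g (X * Y) = (tform f g X : k) * (tform f g Y : k).
Proof.
move=> hf hg; elim/tens_ind: X => [|c x x' hx hx'|a b].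
- by rewrite mul0r !raddf0 mul0r.
- rewrite mulrDl -scalerAl !linearP /= hx hx'.
  by rewrite -![_ *: _]/(_ * _); ring.
elim/tens_ind: Y => [|c X Y hX hY|u v].
- by rewrite mulr0 !raddf0 mulr0.
- rewrite mulrDr -scalerAr !linearP /= hX hY.
  by rewrite -![_ *: _]/(_ * _); ring.
- by rewrite dtens_mul !tform_pure hf.2 hg.2; ring.
Qed.

(* conv restated for forms, so that all occurrences of tform use the same
   instance of the module structure on H. *)
Definition convolution f g : form := tform f g \o Delta V.

Lemma convolution_char f g : is_char f -> is_char g -> is_char (convolution f g).
Proof.
move=> hf hg; split=> [|x y]; rewrite /convolution /=.
  rewrite (rmorph1 (Delta V)); apply: etrans (tform_pure f g 1 1) _.
  by rewrite hf.1 hg.1 mulr1.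
by rewrite (rmorphM (Delta V)); exact: tform_charM.
Qed.

Lemma on_words_convolution f g s : is_char g -> s != [::] ->
  on_words (convolution f g) s
    = cutsum (on_words g) (on_words g) (on_words f) s.
Proof.
move=> hg; case: s => // x s hs; rewrite -tform_delta //.
by rewrite /on_words /convolution /= /dword /Delta bliftE big_seq1.
Qed.

Lemma convolution_counitl g : is_char g -> convolution e g =1 g.
Proof.
move=> hg; apply: eq_char => // [|s hs]; first exact: convolution_char counit_char hg.
rewrite on_words_convolution // (eq_cutsum_fun (frefl _) (frefl _) (@on_words_counit k V)).
exact: cutsum_isnil.
Qed.

Lemma convolution_counitr g : is_char g -> convolution g e =1 g.
Proof.
move=> hg; apply: eq_char => // [|s hs]; first exact: convolution_char hg counit_char.
rewrite on_words_convolution //; last exact: counit_char.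
rewrite (eq_cutsum_fun (@on_words_counit k V) (@on_words_counit k V) (frefl _)).
exact: cutsum_isnil_all.
Qed.

Lemma Delta_half1 P : Delta_half V P 1 = 0.
Proof. exact: wlift_word. Qed.

Lemma Delta_half_bword P t ts :
  Delta_half V P (bword (t :: ts)) = delta V P t * Delta V (bword ts).
Proof. exact: wlift_word. Qed.

(** The entries after the first are evaluated by the convolution of the counit with [g], which is
    [g]. *)
Lemma tform_prec_plus alpha g s ts :
  infinitesimal alpha -> is_char g -> s != [::] ->
  tform alpha g (Delta_prec_plus V (bword (tword s :: ts)))
    = cutsum (on_words g) (@isnil k V) (on_words alpha) s * (g (bword ts) : k).
Proof.
move=> h hg hs; rewrite [Delta_prec_plus _ _]Delta_half_bword -tform_delta_prec //.
rewrite delta_word // mulr_suml !raddf_sum mulr_suml.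
apply: eq_bigr => m hm.
(* The subset contains the first position, so its word is not empty. *)
have hm0 : e (dword (nonempty [:: mask m s])) = 0.
  by case: s hs m hm => // x s _ [[|[] m] //= _] _; exact: counit_bword.
apply: etrans (tform_mul_inf _ _ h hg hm0) _; rewrite -tform_pure.
by congr (_ * _); exact: convolution_counitl.
Qed.

Lemma tform_succ_plus g alpha s ts :
  infinitesimal alpha -> is_char g -> s != [::] ->
  tform g alpha (Delta_succ_plus V (bword (tword s :: ts)))
    = cutsum (@isnil k V) (on_words alpha) (on_words g) s * (g (bword ts) : k).
Proof.
move=> h hg hs; rewrite [Delta_succ_plus _ _]Delta_half_bword -tform_delta_succ //.
rewrite delta_word // mulr_suml !raddf_sum mulr_suml.
apply: eq_bigr => m hm.
have hm0 : e (dword (gaps m s)) = 0.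
  by case: s hs m hm => // x s _ [[|[] m] //= _] _; exact: counit_bword.
apply: etrans (tform_inf_mul _ _ h hg hm0) _; rewrite -tform_pure.
by congr (_ * _); exact: convolution_counitr.
Qed.

End HalfProducts.

(** * Fixed point equations on words *)

Section FixedPoints.
Variables (R : comNzRingType) (T : Type).
Implicit Types (F a : seq T -> R).

(* The restrictions to words of Phi = e + alpha < Phi and Phi = e + Phi > alpha:
   taking isnil as first-gap function keeps the subsets containing 1, and taking
   it for the later gaps keeps those whose complement is an interval. *)
Definition prec_eq a F := forall w, F w = isnil R w + cutsum F (@isnil R T) a w.
Definition succ_eq a F := forall w, F w = isnil R w + cutsum (@isnil R T) a F w.

Lemma prec_eq_nil a F : a [::] = 0 -> prec_eq a F -> F [::] = 1.
Proof. by move=> ha ->; rewrite /= ha mul0r addr0. Qed.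

Lemma succ_eq_nil a F : a [::] = 0 -> succ_eq a F -> F [::] = 1.
Proof. by move=> ha ->; rewrite /= ha mulr0 addr0. Qed.

Lemma prec_eq_cons a F x w :
  prec_eq a F -> F (x :: w) = cutsum F F (fun u => a (x :: u)) w.
Proof. by move=> ->; rewrite cutsum_isnil_first /isnil add0r. Qed.

Lemma succ_eq_cons a F x w : a [::] = 0 ->
  succ_eq a F -> F (x :: w) = splitsum (fun u => a (x :: u)) F w.
Proof. by move=> ha ->; rewrite /= ha mul0r !add0r cutsum_isnil_rest. Qed.

(** At a nonempty word the equation involves [F] only on shorter words, and subwords of a word over
    [p] are again over [p]. *)
Lemma prec_eq_unique (p : pred T) a a' F F' :
  a [::] = 0 -> a' [::] = 0 -> prec_eq a F -> prec_eq a' F' ->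
  (forall w, all p w -> a w = a' w) -> forall w, all p w -> F w = F' w.
Proof.
move=> h h' hF hF' ha w; have [n hn] := ubnP (size w).
elim: n w hn => [//|n ih] [|x w] hn hw.
  by rewrite (prec_eq_nil h hF) (prec_eq_nil h' hF').
rewrite (prec_eq_cons _ _ hF) (prec_eq_cons _ _ hF').
have /andP[hx hw'] := hw.
apply: (eq_cutsum hw') => u hu hs; last by apply: ha; rewrite /= hx.
  by apply: ih => //; apply: (leq_ltn_trans hs).
by apply: ih => //; apply: (leq_ltn_trans hs).
Qed.

Lemma succ_eq_unique (p : pred T) a a' F F' :
  a [::] = 0 -> a' [::] = 0 -> succ_eq a F -> succ_eq a' F' ->
  (forall w, all p w -> a w = a' w) -> forall w, all p w -> F w = F' w.
Proof.
move=> h h' hF hF' ha w; have [n hn] := ubnP (size w).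
elim: n w hn => [//|n ih] [|x w] hn hw.
  by rewrite (succ_eq_nil h hF) (succ_eq_nil h' hF').
rewrite (succ_eq_cons _ _ h hF) (succ_eq_cons _ _ h' hF').
rewrite -!cutsum_isnil_rest; have /andP[hx hw'] := hw.
apply: (eq_cutsum hw') => // u hu hs; first by apply: ha; rewrite /= hx.
by apply: ih => //; apply: (leq_ltn_trans hs).
Qed.

(** [a w] enters the sum only through the full subset, with coefficient [G [::]]. *)
Lemma cutsum_top_diff F G a a' w : F [::] = 1 ->
  (forall u, (size u < size w)%N -> a u = a' u) ->
  cutsum F G a w = cutsum F G a' w + (a w - a' w) * G [::].
Proof.
move=> F1 h; have := @cutsum_top R T predT F G (fun u => -1 * a' u + a u) w F1.
rewrite all_predT cutsum_lin !mulN1r => e.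
rewrite [a w - _]addrC -e ?addrA ?addrN ?add0r //.
by move=> u _ /h ->; rewrite mulN1r addNr.
Qed.

Lemma cutsum_top_first_diff F a a' f w :
  (forall u, (size u < size w)%N -> a u = a' u) ->
  cutsum F a f w = cutsum F a' f w + (a w - a' w) * f [::].
Proof.
move=> h; have := @cutsum_top_first R T F (fun u => -1 * a' u + a u) f w.
rewrite cutsum_lin_first !mulN1r => e.
rewrite [a w - _]addrC -e ?addrA ?addrN ?add0r //.
by move=> u /h ->; rewrite mulN1r addNr.
Qed.

End FixedPoints.

(** * Existence of multilinear solutions *)

Section MultilinearFixedPoints.
Variables (k : fieldType) (V : lmodType k).
Implicit Types (F a f g : seq V -> k).

(** Truncation shows [step] only the values on shorter words. This determines [f], and by induction
    on the length the truncated function is multilinear in all lengths, as [step] requires. *)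
Lemma mlin_rec (step : (seq V -> k) -> seq V -> k) :
  (forall g, (forall m, mlin m g) -> forall m, mlin m (step g)) ->
  exists f, (forall m, mlin m f) /\ forall w, f w = step (trunc (size w) f) w.
Proof.
move=> hstep.
have [f g w h|f hf] := @seq_rec k V (fun f w => step (trunc (size w) f) w).
  congr step; apply: funext => u; rewrite /trunc.
  by case: ifP => // /h.
exists f; split=> //; elim=> [|n ih] c s t x y hs; first by case: ltnP hs.
rewrite !hf !size_cat /= addnS; apply: hstep (leqnn _).
by apply: mlin_trunc; apply: mlinW ih.
Qed.

Lemma mlinD (c : k) n f g : mlin n f -> mlin n g -> mlin n (fun u => f u + c * g u).
Proof. by move=> hf hg a s t x y hs; rewrite hf // hg //; ring. Qed.

Lemma trunc_lt n f u : (size u < n)%N -> trunc n f u = f u.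
Proof. by rewrite /trunc => ->. Qed.

Lemma trunc_size f u : trunc (size u) f u = 0.
Proof. by rewrite /trunc ltnn. Qed.

Lemma prec_eq_char a : a [::] = 0 -> (forall n, mlin n a) ->
  exists F, [/\ F [::] = 1, forall n, mlin n F & prec_eq a F].
Proof.
move=> a0 ha.
have [g hg m|F [hF hw]] := @mlin_rec
    (fun F w => isnil k w + 1 * cutsum F (@isnil k V) a w).
  by apply: mlinD (@mlin_isnil k V _) (cutsum_mlin _ (@mlin_isnil k V _) _).
exists F; have F1 : F [::] = 1 by rewrite hw /= a0 mul0r mulr0 addr0.
split=> // -[|x w]; first by rewrite F1 /= a0 mul0r addr0.
(* The first letter is in the subset, so every gap is shorter than the word and truncation is
   invisible. *)
rewrite hw mul1r !cutsum_isnil_first; congr (_ + _).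
by apply: (@eq_cutsum _ _ predT); rewrite ?all_predT // => u _ hu; rewrite trunc_lt.
Qed.

(** The full subset contributes [a w] with coefficient 1, so the equation can be solved for [a w] in
    terms of shorter words. *)
Lemma prec_eq_inf F : F [::] = 1 -> (forall n, mlin n F) ->
  exists a, [/\ a [::] = 0, forall n, mlin n a & prec_eq a F].
Proof.
move=> F1 hF.
have [g hg m|a [ha hw]] := @mlin_rec (fun a w =>
    F w + -1 * isnil k w + -1 * cutsum F (@isnil k V) a w).
  apply: mlinD (cutsum_mlin _ (@mlin_isnil k V _) _) => //.
  exact: mlinD (@mlin_isnil k V _).
exists a; split=> // [|w]; first by rewrite hw /= F1 /trunc /isnil /=; ring.
rewrite (@cutsum_top_diff _ _ F _ a (trunc (size w) a)) //.
  by rewrite [in a w]hw trunc_size /isnil mulr1; ring.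
by move=> u hu; rewrite trunc_lt.
Qed.

Lemma succ_eq_char a : a [::] = 0 -> (forall n, mlin n a) ->
  exists F, [/\ F [::] = 1, forall n, mlin n F & succ_eq a F].
Proof.
move=> a0 ha.
have [g hg m|F [hF hw]] := @mlin_rec
    (fun F w => isnil k w + 1 * cutsum (@isnil k V) a F w).
  by apply: mlinD (@mlin_isnil k V _) (cutsum_mlin (@mlin_isnil k V _) _ _).
exists F; have F1 : F [::] = 1 by rewrite hw /= a0 !mulr0 addr0.
split=> // -[|x w]; first by rewrite F1 /= a0 mulr0 addr0.
(* The term with empty first gap carries the factor [a [::] = 0]; in the others [F] reads a shorter
   word. *)
rewrite hw mul1r /= a0 !mul0r !add0r.
by apply: (@eq_cutsum _ _ predT); rewrite ?all_predT // => u _ hu; rewrite trunc_lt.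
Qed.

Lemma succ_eq_inf F : F [::] = 1 -> (forall n, mlin n F) ->
  exists a, [/\ a [::] = 0, forall n, mlin n a & succ_eq a F].
Proof.
move=> F1 hF.
have [g hg m|a [ha hw]] := @mlin_rec (fun a w =>
    F w + -1 * isnil k w + -1 * cutsum (@isnil k V) a F w).
  apply: mlinD (cutsum_mlin (@mlin_isnil k V _) _ _) => //.
  exact: mlinD (@mlin_isnil k V _).
exists a; split=> // [|w]; first by rewrite hw /= F1 /trunc /isnil /=; ring.
rewrite (@cutsum_top_first_diff _ _ _ a (trunc (size w) a)) //.
  by rewrite [in a w]hw trunc_size F1; ring.
by move=> u hu; rewrite trunc_lt.
Qed.

End MultilinearFixedPoints.

Lemma theP (T : Type) (d : T) (P : T -> Prop) : (exists x, P x) -> P (the d P).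
Proof. by rewrite /the; case: pselect => // h _; exact: (projT2 (cid h)). Qed.

(** * Half-shuffle exponentials, logarithms and additive convolutions *)

Section Exponentials.
Variables (k : fieldType) (V : lmodType k).
Local Notation H := (tbar (tpos V)).
Local Notation form := {linear H -> k^o}.
Local Notation character := {lrmorphism H -> k^o}.
Local Notation e := (char_form (counit V)).
Implicit Types (f g alpha : form) (s : seq V) (x y a b : H).

Lemma eq_form f g : f 1 = g 1 ->
  (forall s ts, s != [::] -> f (bword (tword s :: ts)) = g (bword (tword s :: ts))) ->
  f =1 g.
Proof.
move=> h1 h; elim/bword_ind => [|c x y hx hy|[|t ts]] //; first by rewrite !raddf0.
  by rewrite !linearP /= hx hy.
have hl f' : linear (fun t => (f' : form) (bword (t :: ts))).
  move=> c x y; rewrite -linearP; congr (f' _).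
  exact: (@bword_multilinear k (tpos V) c [::]).
elim/word_ind: t => [|c x y hx hy|s hs].
- by rewrite (lin0 (hl f)) (lin0 (hl g)).
- by rewrite (hl f c x y) (hl g c x y) /= hx hy.
- exact: h.
Qed.

Lemma char_bword g s ts : is_char g -> s != [::] ->
  g (bword (tword s :: ts)) = on_words g s * (g (bword ts) : k) :> k.
Proof. by case: s => // x s hg _; rewrite -cat1s -bwordM hg.2. Qed.

Lemma infinitesimal_bword alpha s ts : infinitesimal alpha -> s != [::] ->
  alpha (bword (tword s :: ts)) = on_words alpha s * (e (bword ts) : k) :> k.
Proof.
case: s => // x s h _; rewrite -cat1s -bwordM infinitesimal_mul //.
by rewrite counit_bword mul0r addr0.
Qed.

Lemma tform_reduced alpha g (X : tens H H) : alpha 1 = 0 -> is_char g ->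
  tform (reduced alpha) (reduced g) X = (tform alpha g X : k) - (tform alpha e X : k) :> k.
Proof.
move=> ha hg; elim/tens_ind: X => [|c X Y hX hY|u v].
- by rewrite !raddf0 addr0.
- rewrite !linearP /= hX hY -![_ *: _]/(_ * _).
  by ring.
- by rewrite !tform_pure (reduced_eq u ha) reduced_char // mulrBr.
Qed.

Lemma tform_reduced_succ alpha g (X : tens H H) : alpha 1 = 0 -> is_char g ->
  tform (reduced g) (reduced alpha) X = (tform g alpha X : k) - (tform e alpha X : k) :> k.
Proof.
move=> ha hg; elim/tens_ind: X => [|c X Y hX hY|u v].
- by rewrite !raddf0 addr0.
- rewrite !linearP /= hX hY -![_ *: _]/(_ * _).
  by ring.
- by rewrite !tform_pure (reduced_eq v ha) reduced_char // mulrBl.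
Qed.

Lemma tform_prec_counit alpha x : infinitesimal alpha ->
  tform alpha e (Delta_prec_plus V x) = alpha x.
Proof.
move=> h; apply: (eq_form (f := tform alpha e \o Delta_prec_plus V)) => [|s ts hs] /=.
  by rewrite [Delta_prec_plus _ _]Delta_half1 raddf0 h.1.
rewrite tform_prec_plus //; last exact: counit_char.
rewrite (eq_cutsum_fun (@on_words_counit k V) (frefl _) (frefl _)).
by rewrite cutsum_isnil_all infinitesimal_bword.
Qed.

Lemma tform_succ_counit alpha x : infinitesimal alpha ->
  tform e alpha (Delta_succ_plus V x) = alpha x.
Proof.
move=> h; apply: (eq_form (f := tform e alpha \o Delta_succ_plus V)) => [|s ts hs] /=.
  by rewrite [Delta_succ_plus _ _]Delta_half1 raddf0 h.1.
rewrite tform_succ_plus //; last exact: counit_char.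
rewrite (eq_cutsum_fun (frefl _) (frefl _) (@on_words_counit k V)).
by rewrite cutsum_isnil infinitesimal_bword.
Qed.

(** Reducing [g] subtracts the pairing with the counit, which is [alpha x], and the extra term of
    [half_prec] restores it; [tpure (red x) 1] contributes [alpha x * (g 1 - 1) = 0]. *)
Lemma half_precE alpha g x : infinitesimal alpha -> is_char g ->
  half_prec alpha g x = tform alpha g (Delta_prec_plus V x).
Proof.
move=> h hg; have hr : alpha (red x) = alpha x := reduced_eq x h.1.
rewrite /half_prec tform_reduced //; last exact: h.1.
rewrite /Delta_prec !(raddfB (tform _ _)) /= tform_prec_counit // !tform_pure.
by rewrite hg.1 counit1 mul1r hr; ring.
Qed.

Lemma half_succE alpha g x : infinitesimal alpha -> is_char g ->
  half_succ g alpha x = tform g alpha (Delta_succ_plus V x).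
Proof.
move=> h hg; have hr : alpha (red x) = alpha x := reduced_eq x h.1.
rewrite /half_succ tform_reduced_succ //; last exact: h.1.
rewrite /Delta_succ !(raddfB (tform _ _)) /= tform_succ_counit // !tform_pure.
by rewrite hg.1 counit1 mul1r hr; ring.
Qed.

(** On a nonempty bar word both sides are a value at the first entry times [g] of the rest, so
    single words suffice. *)
Lemma half_prec_eqP alpha g : infinitesimal alpha -> is_char g ->
  (forall x, g x = (counit V x : k) + half_prec alpha g x) <->
  prec_eq (on_words alpha) (on_words g).
Proof.
move=> h hg; have a0 : on_words alpha [::] = 0 := h.1.
split=> [hx [|x s]|hs x].
- by rewrite on_words_char_nil // /= a0 mul0r addr0.
- rewrite {1}/on_words hx half_precE // tform_prec_plus //.
  by rewrite bword0 hg.1 mulr1 [counit V _]counit_bword.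
rewrite half_precE //.
apply: (eq_form (g := e \+ (tform alpha g \o Delta_prec_plus V))) => [|s ts nz] /=.
  by rewrite [Delta_prec_plus _ _]Delta_half1 raddf0 addr0 hg.1 counit1.
rewrite tform_prec_plus // char_bword // hs counit_bword add0r.
by case: s nz => // x' s _; rewrite /isnil add0r.
Qed.

Lemma half_succ_eqP alpha g : infinitesimal alpha -> is_char g ->
  (forall x, g x = (counit V x : k) + half_succ g alpha x) <->
  succ_eq (on_words alpha) (on_words g).
Proof.
move=> h hg; have a0 : on_words alpha [::] = 0 := h.1.
split=> [hx [|x s]|hs x].
- by rewrite on_words_char_nil // /= a0 mulr0 addr0.
- rewrite {1}/on_words hx half_succE // tform_succ_plus //.
  by rewrite bword0 hg.1 mulr1 [counit V _]counit_bword.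
rewrite half_succE //.
apply: (eq_form (g := e \+ (tform g alpha \o Delta_succ_plus V))) => [|s ts nz] /=.
  by rewrite [Delta_succ_plus _ _]Delta_half1 raddf0 addr0 hg.1 counit1.
rewrite tform_succ_plus // char_bword // hs counit_bword add0r.
by case: s nz => // x' s _; rewrite /isnil add0r.
Qed.

Lemma char_of_words (F : seq V -> k) : F [::] = 1 -> (forall n, mlin n F) ->
  exists Phi : character, on_words (char_form Phi) =1 F.
Proof.
move=> F1 hF; pose t := wlift (multilinear_of_mlin hF).
exists (blift (t : {linear tpos V -> k^o})) => -[|x s].
  by rewrite on_words_char_nil //; exact: char_formP.
rewrite /on_words /char_form /= /dword bliftE big_seq1.
exact: (wlift_word (multilinear_of_mlin hF) (s := x :: s) isT).
Qed.

Lemma infinitesimal_of_words (a : seq V -> k) : a [::] = 0 -> (forall n, mlin n a) ->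
  exists alpha, infinitesimal alpha /\ on_words alpha =1 a.
Proof.
move=> a0 ha; pose t : {linear tpos V -> k^o} := wlift (multilinear_of_mlin ha).
(* The form lives on bar words with exactly one entry. *)
pose fn (ts : seq (tpos V)) : k^o := if ts is [:: x] then t x else 0.
have hfn : multilinear (@lin_comb k (tpos V)) predT fn.
  have z c : 0 = c *: 0 + 0 :> k^o by rewrite scaler0 addr0.
  move=> c [|? [|? ?]] [|? ?] x y _ -> _ _ _ //=; exact: linearP.
have fE ts : wlift hfn (bword ts) = fn ts by exact: wlift_word.
exists (wlift hfn); split; last first.
  case=> [|x s]; first by rewrite on_words_nil -bword0 fE a0.
  rewrite /on_words /= /dword fE.
  exact: (wlift_word (multilinear_of_mlin ha) (s := x :: s) isT).
split=> [|x y]; first by rewrite -bword0 fE.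
(* The derivation rule over the counit is bilinear, hence checked on bar words; it gives the
   vanishing on products. *)
have -> : wlift hfn (x * y)
    = (wlift hfn x : k) * (e y : k) + (e x : k) * (wlift hfn y : k) :> k.
  elim/bword_ind: x => [|c x x' hx hx'|s].
  - by rewrite mul0r !raddf0 !mul0r addr0.
  - rewrite mulrDl -scalerAl !linearP /= hx hx' -![_ *: _]/(_ * _).
    by ring.
  elim/bword_ind: y => [|c y y' hy hy'|u].
  - by rewrite mulr0 !raddf0 !mulr0 addr0.
  - rewrite mulrDr -scalerAr !linearP /= hy hy' -![_ *: _]/(_ * _).
    by ring.
  rewrite bwordM !fE.
  case: s => [|z s]; first by rewrite bword0 /= counit1 mul0r mul1r add0r.
  case: u => [|z' u]; first by rewrite bword0 cats0 counit1 !mulr1 mulr0 addr0.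
  by rewrite !counit_bword mulr0 mul0r addr0 /=; case: s.
by move=> hx hy; rewrite /char_form /= hx hy mulr0 mul0r addr0.
Qed.

Lemma mlin_on_words f n : mlin n (on_words f).
Proof.
move=> c s t x y _; have nz z : nonempty [:: s ++ z :: t] = [:: s ++ z :: t].
  by case: s.
rewrite /on_words !nz -linearP; congr (f _).
exact: (dword_lin c x y [::] s t [::]).
Qed.

(** The choice made by [the] satisfies the equation once a solution exists; one is built on words
    and extended to a character. *)
Lemma E_precP alpha : infinitesimal alpha ->
  prec_eq (on_words alpha) (on_words (char_form (E_prec alpha))).
Proof.
move=> h; apply/(half_prec_eqP h (char_formP _)).
apply: (@theP _ (counit V) (fun Phi : character =>
    forall x, Phi x = (counit V x : k) + half_prec alpha Phi x)).
have [//|n|F [F1 hF hw]] := @prec_eq_char k V (on_words alpha); first exact: h.1.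
  by exact: mlin_on_words.
have [Phi hPhi] := char_of_words F1 hF; exists Phi.
apply/(half_prec_eqP h (char_formP Phi)) => s.
by rewrite (eq_cutsum_fun hPhi (frefl _) (frefl _)) hPhi hw.
Qed.

Lemma E_succP alpha : infinitesimal alpha ->
  succ_eq (on_words alpha) (on_words (char_form (E_succ alpha))).
Proof.
move=> h; apply/(half_succ_eqP h (char_formP _)).
apply: (@theP _ (counit V) (fun Phi : character =>
    forall x, Phi x = (counit V x : k) + half_succ Phi alpha x)).
have [//|n|F [F1 hF hw]] := @succ_eq_char k V (on_words alpha); first exact: h.1.
  exact: mlin_on_words.
have [Phi hPhi] := char_of_words F1 hF; exists Phi.
apply/(half_succ_eqP h (char_formP Phi)) => s.
by rewrite (eq_cutsum_fun (frefl _) (frefl _) hPhi) hPhi hw.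
Qed.

(** Surjectivity of [E_prec]: solving the word equation for [a] yields an infinitesimal form, and
    uniqueness identifies its exponential with [Phi]. *)
Lemma L_precP (Phi : character) : infinitesimal (L_prec Phi) /\
  prec_eq (on_words (L_prec Phi)) (on_words (char_form Phi)).
Proof.
have hPhi := char_formP Phi.
have [h1 h2] : infinitesimal (L_prec Phi) /\ E_prec (L_prec Phi) =1 Phi.
  apply: (@theP _ (\0 : form)
    (fun alpha => infinitesimal alpha /\ E_prec alpha =1 Phi)).
  have [//|n|a [a0 ha hw]] := @prec_eq_inf k V (on_words (char_form Phi)).
  - exact: on_words_char_nil.
  - exact: mlin_on_words.
  have [alpha [halpha ea]] := infinitesimal_of_words a0 ha.
  exists alpha; split=> //.
  apply: (eq_char (char_formP _) hPhi) => s _.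
  apply: (prec_eq_unique (p := predT) halpha.1 a0 (E_precP halpha) hw) => //.
  by rewrite all_predT.
split=> // s; have := E_precP h1 s.
have e1 : on_words (char_form (E_prec (L_prec Phi))) =1 on_words (char_form Phi).
  by move=> u; exact: h2.
by rewrite (eq_cutsum_fun e1 (frefl _) (frefl _)) e1.
Qed.

Lemma L_succP (Phi : character) : infinitesimal (L_succ Phi) /\
  succ_eq (on_words (L_succ Phi)) (on_words (char_form Phi)).
Proof.
have hPhi := char_formP Phi.
have [h1 h2] : infinitesimal (L_succ Phi) /\ E_succ (L_succ Phi) =1 Phi.
  apply: (@theP _ (\0 : form)
    (fun alpha => infinitesimal alpha /\ E_succ alpha =1 Phi)).
  have [//|n|a [a0 ha hw]] := @succ_eq_inf k V (on_words (char_form Phi)).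
  - exact: on_words_char_nil.
  - exact: mlin_on_words.
  have [alpha [halpha ea]] := infinitesimal_of_words a0 ha.
  exists alpha; split=> //.
  apply: (eq_char (char_formP _) hPhi) => s _.
  apply: (succ_eq_unique (p := predT) halpha.1 a0 (E_succP halpha) hw) => //.
  by rewrite all_predT.
split=> // s; have := E_succP h1 s.
have e1 : on_words (char_form (E_succ (L_succ Phi))) =1 on_words (char_form Phi).
  by move=> u; exact: h2.
by rewrite (eq_cutsum_fun (frefl _) (frefl _) e1) e1.
Qed.

Lemma infinitesimalD alpha beta : infinitesimal alpha -> infinitesimal beta ->
  infinitesimal (alpha \+ beta).
Proof.
move=> [h1 h2] [h1' h2']; split=> [|x y hx hy] /=; first by rewrite h1 h1' addr0.
by rewrite h2 // h2' // addr0.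
Qed.

Lemma box_precP (Phi Psi : character) :
  prec_eq (fun s => on_words (L_prec Phi) s + on_words (L_prec Psi) s)
    (on_words (char_form (box_prec Phi Psi))).
Proof.
have [h _] := L_precP Phi; have [h' _] := L_precP Psi.
exact: (E_precP (infinitesimalD h h')).
Qed.

Lemma box_succP (Phi Psi : character) :
  succ_eq (fun s => on_words (L_succ Phi) s + on_words (L_succ Psi) s)
    (on_words (char_form (box_succ Phi Psi))).
Proof.
have [h _] := L_succP Phi; have [h' _] := L_succP Psi.
exact: (E_succP (infinitesimalD h h')).
Qed.

End Exponentials.

(** * Mixed words *)

Section Vanishing.
Variables (R : comNzRingType) (T : Type).
Implicit Types (F G f a : seq T -> R) (p : pred T).

Definition supported p f := forall u, ~~ all p u -> f u = 0.

(** A letter outside [p] falls into the subset or into some gap. *)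
Lemma cutsum_supported p F G f : supported p F -> supported p G -> supported p f ->
  supported p (cutsum F G f).
Proof.
move=> hF hG hf w; elim: w G f hG hf => [//|z w ih] G f hG hf /=.
case hz : (p z) => hw; last first.
  rewrite (@eq_cutsum _ _ predT F F F F _ (fun=> 0)) ?all_predT //; last first.
    by move=> u _ _; rewrite hf //= hz.
  rewrite (@eq_cutsum _ _ predT F F _ (fun=> 0) f f) ?all_predT //; last first.
    by move=> u _ _; rewrite hG //= hz.
  by rewrite cutsum0 cutsum0_first mulr0 addr0.
rewrite !ih ?mulr0 ?addr0 // => u hu; rewrite ?hf ?hG //= hz //.
Qed.

Definition restrict_to p a u : R := if all p u then a u else 0.

Lemma restrict_to_supported p a : supported p (restrict_to p a).
Proof. by move=> u /negbTE hu; rewrite /restrict_to hu. Qed.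

Lemma isnil_supported p : supported p (@isnil R T).
Proof. by case. Qed.

(** Restricting [a] to words over [p] does not change the sums, and these determine [a] through
    their top terms. *)
Lemma prec_eq_supported p a F :
  a [::] = 0 -> prec_eq a F -> supported p F -> supported p a.
Proof.
move=> a0 hF hp.
have e w : cutsum F (@isnil R T) (restrict_to p a) w = cutsum F (@isnil R T) a w.
  case hw: (all p w).
    by apply: (eq_cutsum hw) => // u hu _; rewrite /restrict_to hu.
  have hw' : ~~ all p w by rewrite hw.
  rewrite (cutsum_supported hp (@isnil_supported p) (@restrict_to_supported p a) hw').
  by have := hF w; rewrite hp // (isnil_supported hw') add0r.
have E w : a w = restrict_to p a w; last first.
  by move=> w hw; rewrite E restrict_to_supported.
have [n hn] := ubnP (size w); elim: n w hn => [//|n ih] w hn.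
have := e w; rewrite (@cutsum_top_diff _ _ F _ a (restrict_to p a)).
- rewrite /isnil mulr1 => h; apply/eqP; rewrite -subr_eq0.
  by rewrite -(addKr (cutsum F (@isnil R T) (restrict_to p a) w) (_ - _)) -h addNr.
- exact: prec_eq_nil hF.
by move=> u hu; apply: ih; apply: leq_trans hu _.
Qed.

Lemma succ_eq_supported p a F :
  a [::] = 0 -> succ_eq a F -> supported p F -> supported p a.
Proof.
move=> a0 hF hp.
have e w : cutsum (@isnil R T) (restrict_to p a) F w = cutsum (@isnil R T) a F w.
  case hw: (all p w).
    by apply: (eq_cutsum hw) => // u hu _; rewrite /restrict_to hu.
  have hw' : ~~ all p w by rewrite hw.
  rewrite (cutsum_supported (@isnil_supported p) (@restrict_to_supported p a) hp hw').
  by have := hF w; rewrite hp // (isnil_supported hw') add0r.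
have E w : a w = restrict_to p a w; last first.
  by move=> w hw; rewrite E restrict_to_supported.
have [n hn] := ubnP (size w); elim: n w hn => [//|n ih] w hn.
have := e w; rewrite (@cutsum_top_first_diff _ _ _ a (restrict_to p a)).
- rewrite (succ_eq_nil a0 hF) mulr1 => h; apply/eqP; rewrite -subr_eq0.
  by rewrite -(addKr (cutsum (@isnil R T) (restrict_to p a) F w) (_ - _)) -h addNr.
by move=> u hu; apply: ih; apply: leq_trans hu _.
Qed.

(** The supports force the subset to consist of the positions of letters in [p]; in an alternating
    word its gaps have length at most one. *)
Lemma cutsum_alternating p F f w : F [::] = 1 -> supported (predC p) F ->
  supported p f -> sorted (fun x y => p x != p y) w ->
  cutsum F F f w = f (filter p w) * \prod_(x <- filter (predC p) w) F [:: x].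
Proof.
move=> F1 hF; have hF0 x f' w' : p x -> cutsum F (fun u => F (x :: u)) f' w' = 0.
  move=> hx; rewrite (@eq_cutsum _ _ predT F F _ (fun=> 0) f' f') ?all_predT //.
    exact: cutsum0_first.
  by move=> u _ _; rewrite hF //= hx.
elim: w f => [|x w ih] f hf hw /=; first by rewrite big_nil F1.
have hw' := path_sorted hw.
case hx : (p x) => /=.
  rewrite F1 mul1r hF0 // addr0 ih //.
  by move=> u hu; apply: hf; rewrite /= hx.
rewrite big_cons mulrCA -ih //.
rewrite (@eq_cutsum _ _ predT F F F F _ (fun=> 0)) ?all_predT //; last first.
  by move=> u _ _; rewrite hf //= hx.
rewrite cutsum0 mulr0 add0r.
(* [x] is in the first gap, and the next letter [y], which satisfies [p], must close that gap. *)
case: w hw {ih hw'} => [_|y w] /=; first by rewrite F1 mulr1 mulrC.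
rewrite hx; case hy : (p y) => //= _.
rewrite (hF0 y) // addr0 F1 mul1r.
rewrite (@eq_cutsum _ _ predT F F (fun u => F [:: x, y & u]) (fun=> 0) f f) ?all_predT //.
  by rewrite cutsum0_first addr0.
by move=> u _ _; rewrite hF //= hy andbF.
Qed.

End Vanishing.

Lemma cutsum_map (R : comNzRingType) (S T : Type) (h : S -> T)
    (F G f : seq T -> R) w :
  cutsum F G f (map h w) = cutsum (F \o map h) (G \o map h) (f \o map h) w.
Proof. by elim: w G f => [//|z w ih] G f /=; rewrite !ih. Qed.

(** * Free products *)

Section Letters.
Variables (k : fieldType) (A1 A2 : nuAlgType k).
Local Notation L := (A1 + A2)%type.
Local Notation A := (free_prod A1 A2).
Implicit Types (w u v p q : seq L) (x y : L).

Definition lcol x : bool := is_inl x.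

Definition lmul x y : L :=
  match x, y with
  | inl a, inl b => inl (nmul a b)
  | inr a, inr b => inr (nmul a b)
  | _, _ => x
  end.

Lemma lcol_mul x y : lcol x = lcol y -> lcol (lmul x y) = lcol x.
Proof. by case: x y => a [] b. Qed.

Lemma mjoinE x y v :
  mjoin x y v = if lcol x == lcol y then lmul x y :: v else [:: x, y & v].
Proof. by case: x y => a [] b. Qed.

(** For nonempty [w], the alternating word that represents the product of its letters in the free
    product. *)
Definition reduce w : seq L := foldr (fun x v => mcat [:: x] v) [::] w.

Lemma reduce_alt w : w != [::] -> alt_word (reduce w).
Proof.
elim: w => [//|x [|y w] ih] _; first by case: x.
by apply: mcat_alt; [case: x|exact: ih].
Qed.

Lemma size_reduce w : (size (reduce w) <= size w)%N.
Proof.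
elim: w => [//|x w ih] /=; case: (reduce w) ih => [//|y v] /= ih.
by rewrite mjoinE; case: ifP => _ //=; rewrite ltnS ltnW.
Qed.

Lemma reduce_id w : alternating w -> reduce w = w.
Proof.
elim: w => [//|x w ih] hw; have hw' := path_sorted hw.
rewrite /= -/(reduce w) ih //; case: w hw {ih hw'} => [//|y w] /= /andP[h _].
by rewrite mjoinE (negbTE h).
Qed.

Lemma reduce_mul p x y q : lcol x = lcol y ->
  reduce (p ++ [:: x, y & q]) = reduce (p ++ lmul x y :: q).
Proof.
move=> h; elim: p => [|z p ih]; last by rewrite /= -!/(reduce _) ih.
rewrite -[LHS]/(mcat [:: x] (mcat [:: y] (reduce q))) -[RHS]/(mcat [:: lmul x y] (reduce q)).
have -> : [:: lmul x y] = mcat [:: x] [:: y] by rewrite /= mjoinE h eqxx.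
by rewrite mcatA.
Qed.

Lemma all_reduce (i : bool) w :
  all (fun x => lcol x == i) (reduce w) = all (fun x => lcol x == i) w.
Proof.
elim: w => [//|x w ih] /=; rewrite -ih; case: (reduce w) => [|y v] //=.
rewrite mjoinE; case: ifP => //= /eqP h.
by rewrite lcol_mul // -h andbA andbb.
Qed.

Lemma letter_mul x y : lcol x = lcol y ->
  nmul (letter x) (letter y : A) = letter (lmul x y).
Proof.
move=> h; have hz (z : L) : alt_word [:: z] by [].
by rewrite nmul_aword //= mjoinE h eqxx.
Qed.

Lemma nprod_aword u w : alt_word u ->
  nprod (aword u : A) (map (@letter k A1 A2) w) = aword (mcat u (reduce w)).
Proof.
elim: w u => [|x w ih] u hu; first by rewrite /= mcat0.
rewrite /nprod /= -/(nprod _ _) nmul_aword // ih ?mcat_alt //.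
by rewrite -mcatA.
Qed.

(** Pulling forms back to words over [A1 + A2] gives every letter a colour. *)
Definition letter_words (f : {linear tbar (tpos A) -> k^o}) w : k :=
  on_words f (map (@letter k A1 A2) w).

Lemma letter_words_aword f w : alt_word w ->
  letter_words f w = f (embed A1 A2 (aword w)).
Proof. by move=> hw; rewrite embed_word //; case: w hw. Qed.

Section CharacterOf.
Variable psi : {linear A -> k^o}.
Local Notation F := (letter_words (char_form (character_of psi))).

Lemma character_words w : w != [::] -> F w = psi (aword (reduce w)).
Proof.
case: w => // x w _; rewrite /letter_words /on_words /char_form /= /dword.
rewrite /character_of bliftE big_seq1 wlift_word //=.
by rewrite (@nprod_aword [:: x]).
Qed.

Lemma character_words_nprod x w :
  F (x :: w) = psi (nprod (letter x) (map (@letter k A1 A2) w)).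
Proof. by rewrite character_words // (@nprod_aword [:: x]). Qed.

Lemma character_words_mul p x y q : lcol x = lcol y ->
  F (p ++ [:: x, y & q]) = F (p ++ lmul x y :: q).
Proof.
by move=> h; rewrite !character_words ?reduce_mul //; case: p.
Qed.

End CharacterOf.

Lemma nprod_inl (x : A1) (s : seq A1) :
  nprod (letter (inl x) : A) (map (@letter k A1 A2) (map inl s))
    = letter (inl (nprod x s)).
Proof.
elim: s x => [//|y s ih] x.
have e := @letter_mul (inl x) (inl y) erefl.
by rewrite /nprod [LHS]/= e; exact: ih.
Qed.

Lemma nprod_inr (x : A2) (s : seq A2) :
  nprod (letter (inr x) : A) (map (@letter k A1 A2) (map inr s))
    = letter (inr (nprod x s)).
Proof.
elim: s x => [//|y s ih] x.
have e := @letter_mul (inr x) (inr y) erefl.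
by rewrite /nprod [LHS]/= e; exact: ih.
Qed.

Lemma filter_lefts w : filter lcol w = map inl (lefts w).
Proof. by elim: w => [|[x|x] w ih] //=; rewrite ih. Qed.

Lemma filter_rights w : filter (predC lcol) w = map inr (rights w).
Proof. by elim: w => [|[x|x] w ih] //=; rewrite ih. Qed.

End Letters.

(** * Moments of the two factors; monotone and anti-monotone products *)

Section Factors.
Variables (k : fieldType) (A1 A2 : nuAlgType k).
Variables (phi1 : {linear A1 -> k^o}) (phi2 : {linear A2 -> k^o}).
Local Notation L := (A1 + A2)%type.
Local Notation A := (free_prod A1 A2).
Local Notation P1 := (Phi1 A2 phi1).
Local Notation P2 := (Phi2 A1 phi2).
Local Notation F1 := (letter_words (char_form P1)).
Local Notation F2 := (letter_words (char_form P2)).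
Implicit Types (w u v p q : seq L) (x y : L).

Local Notation col1 := (fun x : L => lcol x == true).
Local Notation col2 := (fun x : L => lcol x == false).

(** By [all_reduce] the reduced word still has a letter of [A2], and [extend1] vanishes there. *)
Lemma F1_supported : supported col1 F1.
Proof.
move=> w hw; have nz : w != [::] by case: w hw.
rewrite character_words // /extend1 wlift_word ?reduce_alt //.
move: hw; rewrite -all_reduce; by case: (reduce w) => [|[?|?] [|? ?]].
Qed.

Lemma F2_supported : supported col2 F2.
Proof.
move=> w hw; have nz : w != [::] by case: w hw.
rewrite character_words // /extend2 wlift_word ?reduce_alt //.
move: hw; rewrite -all_reduce; by case: (reduce w) => [|[?|?] [|? ?]].
Qed.

Lemma extend1_letter (x : A1) : extend1 A2 phi1 (letter (inl x)) = phi1 x.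
Proof. exact: wlift_word. Qed.

Lemma extend2_letter (x : A2) : extend2 A1 phi2 (letter (inr x)) = phi2 x.
Proof. exact: wlift_word. Qed.

Lemma F1_inl (x : A1) (s : seq A1) : F1 (map inl (x :: s)) = phi1 (nprod x s).
Proof. by rewrite character_words_nprod nprod_inl extend1_letter. Qed.

Lemma F2_inr (x : A2) (s : seq A2) : F2 (map inr (x :: s)) = phi2 (nprod x s).
Proof. by rewrite character_words_nprod nprod_inr extend2_letter. Qed.

Lemma letter_words_char_nil (Phi : {lrmorphism tbar (tpos A) -> k^o}) :
  letter_words (char_form Phi) [::] = 1.
Proof. exact: (rmorph1 Phi). Qed.

Lemma F1_eval (s : seq A1) : F1 (map inl s) = eval_prod phi1 s.
Proof. by case: s => [|x s]; [exact: letter_words_char_nil|exact: F1_inl]. Qed.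

Lemma F2_eval (s : seq A2) : F2 (map inr s) = eval_prod phi2 s.
Proof. by case: s => [|x s]; [exact: letter_words_char_nil|exact: F2_inr]. Qed.

Lemma conv_words (Phi Psi : {lrmorphism tbar (tpos A) -> k^o}) w : w != [::] ->
  letter_words (char_form (conv Phi Psi)) w
    = cutsum (letter_words (char_form Psi)) (letter_words (char_form Psi))
        (letter_words (char_form Phi)) w.
Proof.
move=> hw; rewrite -[RHS]cutsum_map -on_words_convolution.
- by rewrite /letter_words /on_words /char_form /= convE.
- exact: char_formP.
- by case: w hw.
Qed.

Lemma monotone_conv : is_monotone_product phi1 phi2 (restrict (conv P1 P2)).
Proof.
move=> w hw; rewrite [LHS]/= -(letter_words_aword (char_form _) hw).
have /andP[nz hs] := hw.
rewrite conv_words // (@cutsum_alternating _ _ (@lcol k A1 A2)).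
- rewrite filter_lefts F1_eval filter_rights big_map; congr (_ * _).
  by apply: eq_bigr => x _; exact: (F2_inr x [::]).
- exact: letter_words_char_nil.
- by move=> u hu; apply: F2_supported; apply: contraNN hu => /allP h; apply/allP => x /h /eqP /= ->.
- by move=> u hu; apply: F1_supported; apply: contraNN hu => /allP h; apply/allP => x /h /eqP.
- exact: hs.
Qed.

Lemma antimonotone_conv : is_antimonotone_product phi1 phi2 (restrict (conv P2 P1)).
Proof.
move=> w hw; rewrite [LHS]/= -(letter_words_aword (char_form _) hw).
have /andP[nz hs] := hw.
rewrite conv_words // (@cutsum_alternating _ _ (predC (@lcol k A1 A2))).
- have -> : filter (predC (predC (@lcol k A1 A2))) w = filter (@lcol k A1 A2) w.
    by apply: eq_filter => x /=; rewrite negbK.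
  rewrite filter_lefts filter_rights F2_eval big_map; congr (_ * _).
  by apply: eq_bigr => x _; exact: (F1_inl x [::]).
- exact: letter_words_char_nil.
- move=> u hu; apply: F1_supported; apply: contraNN hu => /allP h.
  by apply/allP => x /h /eqP /= ->.
- move=> u hu; apply: F2_supported; apply: contraNN hu => /allP h.
  by apply/allP => x /h /eqP /= ->.
- by apply: sub_sorted hs => x y; rewrite /= (inj_eq negb_inj).
Qed.

End Factors.

Lemma nmul_sumr (k : fieldType) (B : nuAlgType k) (I : Type) (r : seq I)
    (c : I -> k) (v : I -> B) (x : B) :
  nmul x (\sum_(i <- r) c i *: v i) = \sum_(i <- r) c i *: nmul x (v i).
Proof.
elim: r => [|i r ih]; first by rewrite !big_nil (lin0 (nmul_linr _)).
by rewrite !big_cons nmul_linr ih.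
Qed.

(** As [B] may have no unit, [pr [::]] is 0: the empty word is accounted for by the scalar
    component, and by the [isnil] term when a letter is put in front of it. *)
Lemma unitization_expand (k : fieldType) (B : nuAlgType k) (T : eqType)
    (g : T -> B) (pr : seq T -> B) (b : seq (k * T)) :
  pr [::] = 0 ->
  (forall x w, pr (x :: w) = isnil k w *: g x + nmul (g x) (pr w)) ->
  foldr (@unitization_mul k B) (1, 0) [seq (p.1, g p.2) | p <- b]
  = (\sum_(p <- expand b) p.1 * isnil k p.2, \sum_(p <- expand b) p.1 *: pr p.2).
Proof.
move=> pr0 hpr; elim: b => [|[c x] b ih] /=.
  by rewrite !big_seq1 /= pr0 scaler0 mulr1.
rewrite ih /unitization_mul /= !big_cat /= !big_map /= nmul_sumr.
congr (_, _).
  rewrite [X in _ = _ + X]big1 => [|p _]; last by rewrite /isnil mulr0.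
  by rewrite addr0 mulr_sumr; apply: eq_bigr => p _; rewrite mulrA.
rewrite -addrA; congr (_ + _).
  by rewrite scaler_sumr; apply: eq_bigr => p _; rewrite scalerA.
rewrite scaler_suml -big_split; apply: eq_bigr => p _ /=.
by rewrite -scalerA -scalerDr -hpr.
Qed.

(** * Boolean and free products *)

Section Boxes.
Variables (k : fieldType) (A1 A2 : nuAlgType k).
Variables (phi1 : {linear A1 -> k^o}) (phi2 : {linear A2 -> k^o}).
Local Notation L := (A1 + A2)%type.
Local Notation A := (free_prod A1 A2).
Local Notation P1 := (Phi1 A2 phi1).
Local Notation P2 := (Phi2 A1 phi2).
Local Notation F1 := (letter_words (char_form P1)).
Local Notation F2 := (letter_words (char_form P2)).
Local Notation lcol := (@lcol k A1 A2).
Local Notation col1 := (fun x : L => lcol x == true).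
Local Notation col2 := (fun x : L => lcol x == false).
Implicit Types (w u v p q : seq L) (x y : L).

Lemma letter_succ_eq (alpha g : {linear tbar (tpos A) -> k^o}) :
  succ_eq (on_words alpha) (on_words g) ->
  succ_eq (@letter_words k A1 A2 alpha) (letter_words g).
Proof.
have e : @isnil k A \o map (@letter k A1 A2) =1 @isnil k L by case.
move=> h w; rewrite /letter_words h cutsum_map [isnil _ _](e w).
by rewrite (eq_cutsum_fun e (frefl _) (frefl _)).
Qed.

Lemma letter_prec_eq (alpha g : {linear tbar (tpos A) -> k^o}) :
  prec_eq (on_words alpha) (on_words g) ->
  prec_eq (@letter_words k A1 A2 alpha) (letter_words g).
Proof.
have e : @isnil k A \o map (@letter k A1 A2) =1 @isnil k L by case.
move=> h w; rewrite /letter_words h cutsum_map [isnil _ _](e w).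
by rewrite (eq_cutsum_fun (frefl _) e (frefl _)).
Qed.

Lemma supported_mixed (a : seq L -> k) (i : bool) u x y v :
  supported (fun z => lcol z == i) a ->
  lcol x != lcol y -> a (u ++ [:: x, y & v]) = 0.
Proof.
move=> ha h; apply: ha; rewrite all_cat /= !negb_and.
by case: i; case: (lcol x) h; case: (lcol y) => //=; rewrite ?orbT.
Qed.

Local Notation b1 := (@letter_words k A1 A2 (L_succ P1)).
Local Notation b2 := (@letter_words k A1 A2 (L_succ P2)).

Lemma boolean_box_succ : is_boolean_product phi1 phi2 (restrict (box_succ P1 P2)).
Proof.
move=> w hw; rewrite [LHS]/= -(letter_words_aword (char_form _) hw).
have [[h1 e1] [h2 e2]] := (L_succP P1, L_succP P2).
have z1 : b1 [::] = 0 := h1.1.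
have z2 : b2 [::] = 0 := h2.1.
have s1 := succ_eq_supported z1 (letter_succ_eq e1) (@F1_supported k A1 A2 phi1).
have s2 := succ_eq_supported z2 (letter_succ_eq e2) (@F2_supported k A1 A2 phi2).
have hF : succ_eq (fun u => b1 u + b2 u) (letter_words (char_form (box_succ P1 P2))).
  exact: (letter_succ_eq (alpha := L_succ P1 \+ L_succ P2) (@box_succP k A P1 P2)).
have z : b1 [::] + b2 [::] = 0 by rewrite z1 z2 addr0.
have F_nil := succ_eq_nil z hF.
have hb1 (x : A1) : b1 [:: inl x] = phi1 x.
  rewrite -(F1_inl A2 phi1 x [::]) (succ_eq_cons (inl x) [::] z1 (letter_succ_eq e1)) /=.
  by rewrite (rmorph1 P1 : P1 (dword [::]) = 1) mulr1.
have hb2 (x : A2) : b2 [:: inr x] = phi2 x.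
  rewrite -(F2_inr A1 phi2 x [::]) (succ_eq_cons (inr x) [::] z2 (letter_succ_eq e2)) /=.
  by rewrite (rmorph1 P2 : P2 (dword [::]) = 1) mulr1.
(* An infinitesimal value reaching beyond [x] would see two adjacent letters of different
   algebras. *)
have step x v : alternating (x :: v) ->
    letter_words (char_form (box_succ P1 P2)) (x :: v)
    = (b1 [:: x] + b2 [:: x]) * letter_words (char_form (box_succ P1 P2)) v.
  move=> hv; rewrite (succ_eq_cons _ _ z hF); case: v hv => [//|y v] /= /andP[hxy _].
  rewrite splitsum_eq0 ?addr0 // => u.
  by rewrite (supported_mixed [::] _ s1 hxy) (supported_mixed [::] _ s2 hxy) addr0.
have {hw} hs : alternating w by case/andP: hw.
elim: w hs => [_|x w ih hs]; first by rewrite F_nil !big_nil mulr1.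
rewrite step // ih; last exact: path_sorted hs.
case: x {hs} => x /=; rewrite big_cons.
  by rewrite hb1 s2 //= addr0 mulrA.
by rewrite hb2 s1 //= add0r mulrCA.
Qed.

Local Notation c1 := (@letter_words k A1 A2 (L_prec P1)).
Local Notation c2 := (@letter_words k A1 A2 (L_prec P2)).
Definition free_cumulant u : k := c1 u + c2 u.
Local Notation kappa := free_cumulant.
Local Notation F := (letter_words (char_form (box_prec P1 P2))).

Lemma c1_nil : c1 [::] = 0. Proof. exact: (L_precP P1).1.1. Qed.
Lemma c2_nil : c2 [::] = 0. Proof. exact: (L_precP P2).1.1. Qed.

Lemma c1_supported : supported col1 c1.
Proof.
apply: prec_eq_supported c1_nil (letter_prec_eq (L_precP P1).2) _.
exact: F1_supported.
Qed.

Lemma c2_supported : supported col2 c2.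
Proof.
apply: prec_eq_supported c2_nil (letter_prec_eq (L_precP P2).2) _.
exact: F2_supported.
Qed.

Lemma kappa_nil : kappa [::] = 0. Proof. by rewrite /kappa c1_nil c2_nil addr0. Qed.

Lemma kappa_mixed_eq0 u x y v : lcol x != lcol y -> kappa (u ++ [:: x, y & v]) = 0.
Proof.
move=> h; rewrite /kappa (supported_mixed _ _ c1_supported h).
by rewrite (supported_mixed _ _ c2_supported h) addr0.
Qed.

Lemma F_prec_eq : prec_eq kappa F.
Proof. exact: (letter_prec_eq (alpha := L_prec P1 \+ L_prec P2) (@box_precP k A P1 P2)). Qed.

Lemma F_nil : F [::] = 1.
Proof. exact: prec_eq_nil kappa_nil F_prec_eq. Qed.

Lemma F_letter x : F [:: x] = kappa [:: x].
Proof.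
by rewrite (prec_eq_cons _ _ F_prec_eq) -[LHS]/(kappa [:: x] * F [::]) F_nil mulr1.
Qed.

(** On words over [A1] the cumulants [c2] vanish, so [F] and [F1] solve the same recursion. *)
Lemma F_col1 w : all col1 w -> F w = F1 w.
Proof.
apply: (prec_eq_unique kappa_nil c1_nil F_prec_eq (letter_prec_eq (L_precP P1).2)).
move=> [|x u] hu; first by rewrite kappa_nil c1_nil.
by rewrite /kappa c2_supported ?addr0 //=; case/andP: hu => /eqP ->.
Qed.

Lemma F_col2 w : all col2 w -> F w = F2 w.
Proof.
apply: (prec_eq_unique kappa_nil c2_nil F_prec_eq (letter_prec_eq (L_precP P2).2)).
move=> [|x u] hu; first by rewrite kappa_nil c2_nil.
by rewrite /kappa c1_supported ?add0r //=; case/andP: hu => /eqP ->.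
Qed.

Lemma F_merge u x y v : lcol x = lcol y ->
  F (u ++ [:: x, y & v]) = F (u ++ lmul x y :: v).
Proof.
apply: (@F_mul _ _ lcol (@lmul k A1 A2) F kappa).
- exact: lcol_mul.
- exact: F_nil.
- by move=> z w; exact: prec_eq_cons F_prec_eq.
- exact: kappa_mixed_eq0.
(* On words of one colour [F] agrees with [F1] or [F2], which are computed on products. *)
move=> i p a b q h; have h' := all_mul (@lcol_mul k A1 A2) h.
have hab : lcol a = lcol b.
  by move: h; rewrite all_cat /= => /and4P[_ /eqP -> /eqP ->].
case: i h h' => h h'; first by rewrite !F_col1 // character_words_mul.
by rewrite !F_col2 // character_words_mul.
Qed.

Lemma F_reduce w : F (reduce w) = F w.
Proof.
(* A prefix is carried along because letters merge behind it. *)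
suff h p : F (p ++ w) = F (p ++ reduce w) by rewrite -(h [::]).
elim: w p => [//|x w ih] p.
rewrite -cat_rcons ih cat_rcons -[reduce (x :: w)]/(mcat [:: x] (reduce w)).
case: (reduce w) => [//|y v]; rewrite -[mcat _ _]/(mjoin x y v) mjoinE.
by case: eqP => // /F_merge ->.
Qed.

Definition pair_of (b : (k * A1) + (k * A2)) : k * L :=
  match b with inl p => (p.1, inl p.2) | inr p => (p.1, inr p.2) end.

Lemma unitization_inclE b :
  unitization_incl b = ((pair_of b).1, letter (pair_of b).2 : A).
Proof. by case: b => -[]. Qed.

Definition product_of w : A := if w is [::] then 0 else aword (reduce w).

Lemma product_of_cons x w :
  product_of (x :: w) = isnil k w *: letter x + nmul (letter x) (product_of w).
Proof.
case: w => [|y w]; first by rewrite /isnil scale1r (lin0 (nmul_linr _)) addr0.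
rewrite /isnil scale0r add0r [product_of (y :: w)]/=.
rewrite nmul_aword //; exact: (@reduce_alt k A1 A2 (y :: w)).
Qed.

Lemma unitization_prod (b : seq ((k * A1) + (k * A2))) :
  foldr (@unitization_mul k A) (1, 0) (map (@unitization_incl k A1 A2) b)
  = (\sum_(p <- expand (map pair_of b)) p.1 * isnil k p.2,
     \sum_(p <- expand (map pair_of b)) p.1 *: product_of p.2).
Proof.
have -> : map (@unitization_incl k A1 A2) b
    = [seq (z.1, letter z.2 : A) | z <- map pair_of b].
  by rewrite -map_comp; apply: eq_map => x; rewrite /= unitization_inclE.
exact: (unitization_expand (g := @letter k A1 A2) (pr := product_of) _ (erefl _) product_of_cons).
Qed.

Lemma unital_ext_prod (phi : {linear A -> k^o}) (b : seq ((k * A1) + (k * A2))) :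
  unital_ext phi
    (foldr (@unitization_mul k A) (1, 0) (map (@unitization_incl k A1 A2) b))
  = \sum_(p <- expand (map pair_of b)) p.1 * (isnil k p.2 + phi (product_of p.2)).
Proof.
rewrite unitization_prod /unital_ext /= raddf_sum -big_split.
by apply: eq_bigr => p _; rewrite mulrDr; congr (_ + _);
  exact: (linearZ_LR phi).
Qed.

Lemma free_box_prec : is_free_product phi1 phi2 (restrict (box_prec P1 P2)).
Proof.
have hrestr w : alt_word w -> restrict (box_prec P1 P2) (aword w) = F w.
  by move=> hw; rewrite letter_words_aword.
split=> [x|x|b nb hb hc].
- by rewrite hrestr // F_col1 // -[phi1 x](F1_inl A2 phi1 x [::]).
- by rewrite hrestr // F_col2 // -[phi2 x](F2_inr A1 phi2 x [::]).
(* The scalar part of the unital extension supplies the value 1 at the empty word. *)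
have hF w : isnil k w + restrict (box_prec P1 P2) (product_of w) = F w.
  case: w => [|x w]; first by rewrite raddf0 addr0 F_nil.
  by rewrite /isnil add0r hrestr ?F_reduce //; exact: (@reduce_alt k A1 A2 (x :: w)).
rewrite unital_ext_prod.
(* With [F] written as the sum with functional [isnil], the whole expansion becomes [isnil] of a
   nonempty word. *)
under eq_bigr => p _ do rewrite hF -(cutsum_isnil F).
rewrite (@expand_centered _ _ lcol F kappa).
- by case: b nb {hb hc}.
- exact: F_nil.
- by move=> z w; exact: prec_eq_cons F_prec_eq.
- exact: kappa_mixed_eq0.
- by rewrite sorted_map; apply: sub_sorted hb => -[x|x] [y|y].
move=> _ /mapP[x hx ->]; have := hc x hx.
rewrite unitization_inclE -[unital_ext _ _]/((pair_of x).1
  + restrict (box_prec P1 P2) (aword [:: (pair_of x).2])) hrestr //.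
by rewrite F_letter.
Qed.

(** Freeness applied to the centred letters of an alternating word expresses the value at this word
    through values at shorter words. *)
Lemma free_product_unique (phi psi : {linear A -> k^o}) :
  is_free_product phi1 phi2 phi -> is_free_product phi1 phi2 psi -> phi =1 psi.
Proof.
move=> [h1 h2 hfree] [h1' h2' hfree'].
apply: eq_word_linear => w; have [n hn] := ubnP (size w).
elim: n w hn => [//|n ih] w hn hw.
pose centre x : (k * A1) + (k * A2) :=
  match x with inl a => inl (- phi1 a, a) | inr a => inr (- phi2 a, a) end.
have hz : [seq z.2 | z <- map pair_of (map centre w)] = w.
  by rewrite -!map_comp -[RHS]map_id; apply: eq_map => -[x|x].
have /andP[nw aw] := hw.
have key (f : {linear A -> k^o}) :
    (forall x : A1, f (letter (inl x)) = phi1 x) ->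
    (forall x : A2, f (letter (inr x)) = phi2 x) -> freely_independent f ->
    \sum_(z <- expand (map pair_of (map centre w)))
      z.1 * (isnil k z.2 + f (product_of z.2)) = 0.
  move=> g1 g2 hf; rewrite -unital_ext_prod; apply: hf.
  - by case: (w) nw.
  - by rewrite /alternating sorted_map; apply: sub_sorted aw => -[x|x] [y|y].
  by move=> _ /mapP[[x|x] _ ->]; rewrite /unital_ext /= ?g1 ?g2 addNr.
have := etrans (key phi h1 h2 hfree) (esym (key psi h1' h2' hfree')).
have [E -> hE] := expand_top (map pair_of (map centre w)).
rewrite !big_rcons /= hz !mul1r.
rewrite !size_map in hE.
have pw : product_of w = aword w by rewrite /product_of reduce_id //; case: (w) nw.
(* These terms have fewer letters, and reduction does not lengthen them, so the induction hypothesis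
   applies. *)
have -> : \sum_(z <- E) z.1 * (isnil k z.2 + psi (product_of z.2))
    = \sum_(z <- E) z.1 * (isnil k z.2 + phi (product_of z.2)).
  elim: E hE => [|z E ihE] /=; first by rewrite !big_nil.
  case/andP=> hp /ihE hE; rewrite !big_cons hE; congr (_ * (_ + _) + _).
  case: z hp => c [|x u] /= hp; first by rewrite !raddf0.
  apply/esym/ih; last exact: (@reduce_alt k A1 A2 (x :: u)).
  apply: leq_ltn_trans (@size_reduce k A1 A2 (x :: u)) _.
  exact: leq_trans hp _.
by rewrite pw => /addrI/addrI ->.
Qed.

End Boxes.

Theorem theorem32 (k : fieldType) (char0 : [pchar k] =i pred0)
    (A1 A2 : nuAlgType k)
    (phi1 : {linear A1 -> k^o}) (phi2 : {linear A2 -> k^o}) :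
  let P1 := Phi1 A2 phi1 in
  let P2 := Phi2 A1 phi2 in
  [/\ forall phi : {linear free_prod A1 A2 -> k^o},
        is_monotone_product phi1 phi2 phi <-> phi =1 restrict (conv P1 P2),
      forall phi : {linear free_prod A1 A2 -> k^o},
        is_antimonotone_product phi1 phi2 phi <-> phi =1 restrict (conv P2 P1),
      forall phi : {linear free_prod A1 A2 -> k^o},
        is_free_product phi1 phi2 phi <-> phi =1 restrict (box_prec P1 P2)
    & forall phi : {linear free_prod A1 A2 -> k^o},
        is_boolean_product phi1 phi2 phi <-> phi =1 restrict (box_succ P1 P2)].
Proof.
move=> P1 P2; split=> phi; split=> h.
- by apply: eq_word_linear => w hw; rewrite [LHS]h // -monotone_conv.
- by move=> w hw; rewrite h monotone_conv.
- by apply: eq_word_linear => w hw; rewrite [LHS]h // -antimonotone_conv.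
- by move=> w hw; rewrite h antimonotone_conv.
- by apply: free_product_unique h _; exact: free_box_prec.
- have [g1 g2 g3] := free_box_prec phi1 phi2.
  split=> [x|x|b nb hb hc]; rewrite ?h //.
  rewrite /unital_ext h; apply: g3 => // x hx.
  by have := hc x hx; rewrite /unital_ext h.
- by apply: eq_word_linear => w hw; rewrite [LHS]h // -boolean_box_succ.
- by move=> w hw; rewrite h boolean_box_succ.
Qed.
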